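(* Let $\mathcal{N}$ be a connected three-cell network with $k\ge 1$ asymmetric inputs. Then the annotated synchrony lattice of $\mathcal{N}$ is one of the following seven. In each, the bottom is the full-synchrony subspace $\Delta_0=\{x_1=x_2=x_3\}$, annotated with $\upsilon$, the top is $\mathbb{R}^3$, and the only other elements are the listed two-dimensional synchrony subspaces, which lie between bottom and top and are pairwise incomparable. Distinct symbols denote distinct network eigenvalues. (a) One two-dimensional synchrony subspace, annotated $\{\upsilon,\mu\}$; top annotated $\{\upsilon,\upsilon,\mu\}$ ($\upsilon$ of algebraic multiplicity $2$, $\mu$ of algebraic multiplicity $1$). (b) Three two-dimensional synchrony subspaces, each annotated $\{\upsilon,\mu\}$; top annotated $\{\upsilon,\mu,\mu\}$ ($\upsilon$ of algebraic multiplicity $1$, $\mu$ of geometric multiplicity $2$). (c) One two-dimensional synchrony subspace, annotated $\{\upsilon,\mu\}$; top annotated $\{\upsilon,\mu^*\}$ ($\upsilon$ of algebraic multiplicity $1$, $\mu$ of algebraic multiplicity $2$ and geometric multiplicity $1$). (d) No two-dimensional synchrony subspace; top annotated $\{\upsilon,\mu^*\}$ ($\upsilon$ of algebraic multiplicity $1$, $\mu$ of algebraic multiplicity $2$ and geometric multiplicity $1$). (e) Two two-dimensional synchrony subspaces, annotated $\{\upsilon,\mu_1\}$ and $\{\upsilon,\mu_2\}$ respectively; top annotated $\{\upsilon,\mu_1,\mu_2\}$ (all of algebraic multiplicity $1$). (f) One two-dimensional synchrony subspace, annotated $\{\upsilon,\mu_1\}$; top annotated $\{\upsilon,\mu_1,\mu_2\}$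 (all of algebraic multiplicity $1$). (g) No two-dimensional synchrony subspace; top annotated $\{\upsilon,\mu_1,\mu_2\}$ (all of algebraic multiplicity $1$).
   Context: **Networks.** A three-cell network $\mathcal{N}$ with $k$ asymmetric inputs has cells $1,2,3$ and edges of $k$ types, each cell receiving exactly one edge of each type. It is given by $3\times3$ adjacency matrices $A_1,\dots,A_k$, where $(A_l)_{ij}=1$ if the edge of type $l$ ending at $i$ starts at $j$, and $0$ otherwise. It is connected if there is an undirected path between any two cells. **Jacobian and network eigenvalues.** A smooth $f:\mathbb{R}\times\mathbb{R}^k\times\mathbb{R}\to\mathbb{R}$ (last variable the parameter $\lambda$) defines the coupled cell system $f^{\mathcal{N}}$, $f^{\mathcal{N}}_i(x,\lambda)=f(x_i,x_{i_1},\dots,x_{i_k},\lambda)$, where $i_j$ is the source of the type-$j$ edge ending at $i$. Its Jacobian at the origin is $J_f^{\mathcal{N}}=f_0\,\mathrm{Id}_3+\sum_{j=1}^kf_jA_j$, where $f_j$ is the derivative of $f$ at the origin with respect to its $(j+1)$-th variable. The network eigenvalues are the continuous functions of $(f_0,\dots,f_k)\in\mathbb{R}^{k+1}$ giving the distinct eigenvalues of $J_f^{\mathcal{N}}$ for generic $f$ (i.e. for $f$ satisfying finitely many non-trivial inequalities $\neq$ on its derivatives at the origin). The valency eigenvalue is $\upsilon=\sum_{j=0}^kf_j$. Multiplicities are those as eigenvalues of $J_f^{\mathcal{N}}$ for generic $f$. **Annotated synchrony lattice.** A synchrony subspace is a polydiagonal (subspace of $\mathbb{R}^3$ defined by equalities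 $x_i=x_j$) invariant under every admissible vector field, equivalently under all $A_l$. The synchrony subspaces ordered by inclusion form a lattice. The restriction of $f^{\mathcal{N}}$ to a synchrony subspace $\Delta$ is the coupled cell system defined by $f$ on a quotient network; the annotated lattice labels each $\Delta$ with the network eigenvalues of that quotient, repeated according to multiplicity, except that a defective eigenvalue (algebraic multiplicity $2$, geometric multiplicity $1$) is written once with a star, $\mu^*$. *)

(* Defs.v *)
From HB Require Import structures.
From Stdlib Require List.
From mathcomp Require Import all_boot all_order all_algebra.
From mathcomp Require Import boolp classical_sets functions reals.
From mathcomp Require Import topology normedtype derive.
From mathcomp Require Import complex.
(* The notations of mpoly clash with those of MathComp-Analysis. *)
From mathcomp Require Import -(notations) mpoly.

Set Implicit Arguments.
Unset Strict Implicit.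
Unset Printing Implicit Defensive.

Import Order.TTheory GRing.Theory Num.Theory.
Import numFieldNormedType.Exports.

Local Open Scope ring_scope.

(* [N l i] is the source of the unique edge of type [l] ending at cell [i]. *)
Definition network (n k : nat) := 'I_k -> 'I_n -> 'I_n.

Definition net_connected n k (N : network n k) : Prop :=
  forall i j : 'I_n,
    connect (fun a b => [exists l, (N l a == b) || (N l b == a)]) i j.

Definition adjacency (R : realType) n k (N : network n k) (l : 'I_k) :
  'M[R]_n := \matrix_(i, j) (N l i == j)%:R.

(* All iterated directional derivatives exist and are (Fréchet)
   differentiable everywhere; on finite-dimensional spaces this is C^oo. *)
Definition smooth (R : realType) (V W : normedModType R) (f : V -> W) : Prop :=
  forall (vs : seq V) (x : V),
    differentiable (foldr (fun v g => 'D_v g) f vs) x.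

(* Arguments: state of the cell, states of its k inputs, parameter lambda. *)
Definition cell_function (R : realType) (k : nat) :=
  (R * 'rV[R]_k * R)%type -> R.

Definition admissible (R : realType) n k (N : network n k)
    (f : cell_function R k) (x : 'cV[R]_n) (lambda : R) : 'cV[R]_n :=
  \col_i f (x i 0, \row_l x (N l i) 0, lambda).

(* The direction of the (j+1)-th variable of a cell function, j = 0..k. *)
Definition state_dir (R : realType) k (j : 'I_k.+1) : (R * 'rV[R]_k * R)%type :=
  if unlift ord0 j is Some l then (0, delta_mx 0 l, 0) else (1, 0, 0).

(* The row vector (f_0, ..., f_k). *)
Definition partials (R : realType) k (f : cell_function R k) : 'rV[R]_k.+1 :=
  \row_j 'D_(state_dir R j) f 0.

Definition jacobian (R : realType) n k (N : network n k) (a : 'rV[R]_k.+1) :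
    'M[R]_n :=
  (a 0 ord0)%:M + \sum_(l < k) a 0 (lift ord0 l) *: adjacency R N l.

(* Eigenvalues are taken in the complex field. *)
Definition jacobianC (R : realType) n k (N : network n k) (a : 'rV[R]_k.+1) :
    'M[R[i]]_n := map_mx (real_complex R) (jacobian N a).

(* Finitely many non-trivial (polynomial) inequalities <> on f_0, ..., f_k. *)
Definition generic (R : realType) k (P : cell_function R k -> Prop) : Prop :=
  exists ps : seq (mpoly k.+1 R),
    all (fun p => p != 0) ps /\
    forall f : cell_function R k, smooth f ->
      all (fun p => meval (fun j => partials f 0 j) p != 0) ps -> P f.

Definition eigenfun (R : realType) (k : nat) := 'rV[R]_k.+1 -> R[i].

Definition valency (R : realType) k : eigenfun R k :=
  fun a => real_complex R (\sum_(j < k.+1) a 0 j).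

(* [E] lists the network eigenvalues of [N], without repetition. *)
Definition network_eigenvalues (R : realType) n k (N : network n k)
    (E : seq (eigenfun R k)) : Prop :=
  List.Forall (fun mu => continuous (mu : 'rV[R]_k.+1 -> (R[i])^o)) E /\
  generic (fun f : cell_function R k =>
    uniq [seq mu (partials f) | mu : eigenfun R k <- E] /\
    forall z : R[i], eigenvalue (jacobianC N (partials f)) z =
                (z \in [seq mu (partials f) | mu : eigenfun R k <- E])).

Definition alg_mult (R : realType) n (M : 'M[R[i]]_n) (z : R[i]) : nat :=
  mup z (char_poly M).

(* [eigenspace] is made of row vectors, hence the transpose. *)
Definition geo_mult (R : realType) n (M : 'M[R[i]]_n) (z : R[i]) : nat :=
  \rank (eigenspace M^T z).

(* [(mu, Repeated m)] stands for [mu] written m times, [(mu, Starred)] for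
   mu^*; an annotation lists each network eigenvalue once. *)
Inductive decoration := Repeated of nat | Starred.

Definition annotation (R : realType) (k : nat) :=
  seq (eigenfun R k * decoration).

Definition decorates (R : realType) n (M : 'M[R[i]]_n) (z : R[i])
    (d : decoration) : Prop :=
  match d with
  | Repeated m => alg_mult M z = m /\ geo_mult M z = m
  | Starred => alg_mult M z = 2%N /\ geo_mult M z = 1%N
  end.

Definition annotated_network (R : realType) n k (N : network n k)
    (L : annotation R k) : Prop :=
  network_eigenvalues N [seq e.1 | e <- L] /\
  generic (fun f : cell_function R k =>
    List.Forall
      (fun e : eigenfun R k * decoration =>
         decorates (jacobianC N (partials f)) (e.1 (partials f)) e.2) L).

Definition polydiagonal (R : realType) n (D : {vspace 'cV[R]_n}) : Prop :=
  exists E : {set 'I_n * 'I_n}, forall x : 'cV[R]_n,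
    x \in D <-> (forall i j, (i, j) \in E -> x i 0 = x j 0).

Definition synchrony (R : realType) n k (N : network n k)
    (D : {vspace 'cV[R]_n}) : Prop :=
  polydiagonal D /\
  forall f : cell_function R k, smooth f ->
    forall (lambda : R) (x : 'cV[R]_n), x \in D -> admissible N f x lambda \in D.

(* x_1 = ... = x_n *)
Definition full_synchrony (R : realType) n : {vspace 'cV[R]_n} :=
  <[const_mx 1]>%VS.

(* [Q] is the quotient of [N] by the synchrony classes of [D], which are the
   fibres of [p]; it is unique up to a renumbering of its cells. *)
Definition quotient_network (R : realType) n m k (N : network n k)
    (D : {vspace 'cV[R]_n}) (p : 'I_n -> 'I_m) (Q : network m k) : Prop :=
  [/\ forall c : 'I_m, exists i : 'I_n, p i = c,
      forall x : 'cV[R]_n,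
        x \in D <-> (forall i j, p i = p j -> x i 0 = x j 0)
    & forall l i, p (N l i) = Q l (p i)].

Definition annotated_subspace (R : realType) n k (N : network n k)
    (D : {vspace 'cV[R]_n}) (L : annotation R k) : Prop :=
  exists (m : nat) (p : 'I_n -> 'I_m) (Q : network m k),
    quotient_network N D p Q /\ annotated_network Q L.

(* [mids] lists the annotated two-dimensional synchrony subspaces. *)
Definition annotated_lattice (R : realType) k (N : network 3 k)
    (mids : seq ({vspace 'cV[R]_3} * annotation R k))
    (top : annotation R k) : Prop :=
  let Ds := [seq e.1 | e <- mids] in
  [/\ forall D : {vspace 'cV[R]_3},
        synchrony N D <-> D \in full_synchrony R 3 :: fullv :: Ds,
      all (fun D => (\dim D == 2%N) && (full_synchrony R 3 <= D <= fullv)%VS) Ds,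
      pairwise (fun D D' => ~~ (D <= D')%VS && ~~ (D' <= D)%VS) Ds
    & [/\ annotated_subspace N (full_synchrony R 3)
            [:: (@valency R k, Repeated 1%N)],
          List.Forall (fun e => annotated_subspace N e.1 e.2) mids
        & annotated_subspace N fullv top]].

(* Main.v *)
(* The Jacobian J of the network preserves the diagonal line, where it acts by the
   valency v, so everything is read off the 2x2 map B it induces on the quotient
   by that line: J has the eigenvalues v, m1, m2 with m1 + m2 = T and m1 m2 = D,
   where T and D are polynomials in the derivatives of f. A two-dimensional
   synchrony subspace isolates one cell c, and it corresponds to a line of the
   quotient which is invariant under B for all f.
   - If v is always an eigenvalue of B, the matrix-tree expansion of its
     characteristic polynomial at v (a sum of products of non-negative terms when
     all derivatives are 1) and connectedness force two cells to receive only from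
     themselves and the third one to receive from both: case (a).
   - Otherwise, three invariant lines force B to be scalar (b). Two lines carry two
     eigenvalues which cannot coincide identically, since then all lines would be
     invariant (e). With one line or none, the case depends on whether the
     discriminant T^2 - 4 D vanishes identically, (c) or (f), resp. (d) or (g). *)
From HB Require Import structures.
From mathcomp Require Import all_boot all_order all_algebra.
From mathcomp Require Import boolp classical_sets functions reals.
From mathcomp Require Import topology normedtype derive realfun.
From mathcomp Require Import complex.
From mathcomp Require Import -(notations) mpoly.
From mathcomp Require Import ring lra.
(* Last, because MathComp-Analysis also defines [jacobian]. *)
Require Import Defs.

Set Implicit Arguments.
Unset Strict Implicit.
Unset Printing Implicit Defensive.

Import Order.TTheory GRing.Theory Num.Theory.
Import numFieldNormedType.Exports.

Local Open Scope ring_scope.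

(** * Matrices *)

Lemma mup_prod_XsubC (F : fieldType) (s : seq F) (z : F) :
  mup z (\prod_(x <- s) ('X - x%:P)) = count_mem z s.
Proof.
elim: s => [|x s IH]; first by rewrite big_nil mupNroot // rootE hornerC oner_eq0.
rewrite big_cons mupM ?polyXsubC_eq0 ?monic_neq0 ?monic_prod_XsubC // IH /=.
by rewrite -['X - _]expr1 mup_XsubCX; case: eqP.
Qed.

(** Eigenspaces of distinct eigenvalues form a direct sum. *)
Lemma sum_rank_eigenspace (F : fieldType) n (M : 'M[F]_n) (s : seq F) :
  uniq s -> (\sum_(z <- s) \rank (eigenspace M z) <= n)%N.
Proof.
move=> us; rewrite (big_nth 0) big_mkord.
have dx : mxdirect (\sum_(i < size s) eigenspace M s`_i)%MS.
  apply: mxdirect_sum_eigenspace => i j _ _ /eqP.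
  by rewrite nth_uniq // => /eqP /val_inj.
by move: dx => /mxdirectP /= <-; exact: rank_leq_row.
Qed.

Lemma rank_eigenspace (F : fieldType) n (M : 'M[F]_n) (z : F) :
  \rank (eigenspace M z) = (n - \rank (M - z%:M)%R)%N.
Proof. by rewrite mxrank_ker. Qed.

(** [geo_mult] is defined on the transpose; this brings it back to [M] itself. *)
Lemma rank_eigenspaceT (F : fieldType) n (M : 'M[F]_n) (z : F) :
  \rank (eigenspace M^T z) = \rank (eigenspace M z).
Proof. by rewrite !rank_eigenspace -[in LHS]tr_scalar_mx -linearB mxrank_tr. Qed.

Lemma rank_eigenspace_gt0 (F : fieldType) n (M : 'M[F]_n) (z : F) :
  root (char_poly M) z -> (0 < \rank (eigenspace M z))%N.
Proof. by rewrite -eigenvalue_root_char => e; rewrite lt0n mxrank_eq0. Qed.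

(** Factor [A] as a column times a row. *)
Lemma minors_eq0 (F : fieldType) m n (A : 'M[F]_(m, n)) i i' j j' :
  (\rank A <= 1)%N -> A i j * A i' j' = A i j' * A i' j.
Proof.
move=> rA; rewrite -(mulmx_base A); move: (col_base A) (row_base A).
case: (\rank A) rA => [|[|//]] _ C D; rewrite !mxE; first by rewrite !big_ord0 !mul0r.
by rewrite !big_ord1; ring.
Qed.

(** The rows are proportional, and their common nonzero sum fixes the factor to 1. *)
Lemma rank1_rows (F : fieldType) m n (A : 'M[F]_(m, n)) v :
  (\rank A <= 1)%N -> (forall i, \sum_j A i j = v) -> v != 0 ->
  forall i i' j, A i j = A i' j.
Proof.
move=> rA sA v0 i i' j; apply: (mulIf v0).
rewrite -{1}(sA i') -(sA i) mulr_sumr [RHS]mulr_sumr.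
apply: eq_bigr => j' _; rewrite (minors_eq0 _ _ _ _ rA) mulrC; congr (_ * _).
Qed.

Lemma ord3P (i : 'I_3) : [\/ i = 0, i = 1 | i = 2].
Proof.
by case: i => [[|[|[|//]]] h]; [constructor 1|constructor 2|constructor 3];
  apply/val_inj.
Qed.

Lemma big_ord3 (V : nmodType) (i j c : 'I_3) (f : 'I_3 -> V) :
  uniq [:: i; j; c] -> \sum_x f x = f i + f j + f c.
Proof.
move=> u.
have -> : \sum_x f x = \sum_(x <- [:: i; j; c]) f x.
  rewrite -big_enum /=; apply: perm_big; rewrite uniq_perm ?enum_uniq // => x.
  rewrite mem_enum; apply/esym.
  have /subset_leqif_card/geq_leqif e : [:: i; j; c] \subset 'I_3.
    exact/fintype.subsetP.
  by move: e; rewrite (card_uniqP u) card_ord => /esym/fintype.subsetP ->.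
by rewrite !big_cons big_nil addr0 addrA.
Qed.

(** Sarrus' rule in any ordering of the cells: relabelling rows and columns alike preserves the
    determinant, so a special cell can be put last. *)
Lemma det3 (R : comNzRingType) (M : 'M[R]_3) (i j c : 'I_3) :
  uniq [:: i; j; c] ->
  \det M = M i i * M j j * M c c + M i j * M j c * M c i + M i c * M j i * M c j
   - M i i * M j c * M c j - M i j * M j i * M c c - M i c * M j j * M c i.
Proof.
have D : \det M = M 0 0 * M 1 1 * M 2 2 + M 0 1 * M 1 2 * M 2 0
   + M 0 2 * M 1 0 * M 2 1 - M 0 0 * M 1 2 * M 2 1
   - M 0 1 * M 1 0 * M 2 2 - M 0 2 * M 1 1 * M 2 0.
  rewrite (expand_det_row _ 0) !big_ord_recl big_ord0 /cofactor.
  rewrite !(expand_det_row _ 0) !big_ord_recl !big_ord0 /cofactor !det_mx11 !mxE /=.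
  (* All indices become numerals, so that [ring] identifies entries whose ordinals are built
     differently. *)
  pose m a b := M (inord a) (inord b).
  have mE (x y : 'I_3) : M x y = m x y by rewrite /m !inord_val.
  by rewrite !mE /= /bump /= !(exprD, expr0, expr1) ; ring.
rewrite D; case: (ord3P i) (ord3P j) (ord3P c) => -> [] -> [] -> //= _; ring.
Qed.

(* The second factor is the characteristic polynomial of the map induced on the
   quotient by the line of constant vectors. *)
Lemma char_poly_row_sum3 (R : comNzRingType) (M : 'M[R]_3) (v : R) (i j c : 'I_3) :
  uniq [:: i; j; c] -> (forall x, \sum_y M x y = v) ->
  char_poly M = ('X - v%:P) *
    ('X^2 - (\tr M - v) *: 'X +
     ((M i i - M c i) * (M j j - M c j) - (M i j - M c j) * (M j i - M c i))%:P).
Proof.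
move=> u sM; rewrite /char_poly (det3 _ u) !mxE.
have E x : M x c = v - M x i - M x j by rewrite -(sM x) (big_ord3 _ u); ring.
rewrite /mxtrace (big_ord3 _ u) !E.
move: u; rewrite /= !inE !negb_or => /and3P [/andP[ij ic] jc _].
rewrite !eqxx [c == j]eq_sym [c == i]eq_sym [j == i]eq_sym.
rewrite (negPf ij) (negPf ic) (negPf jc) -!mul_polyC.
rewrite !(rmorphB, rmorphD, rmorphM) /= mulr0n mulr1n.
ring.
Qed.

Lemma char_poly_row_sum2 (R : comNzRingType) (M : 'M[R]_2) (v : R) :
  (forall x, \sum_y M x y = v) ->
  char_poly M = ('X - v%:P) * ('X - (\tr M - v)%:P).
Proof.
move=> sM; rewrite /char_poly (expand_det_row _ 0) !big_ord_recl big_ord0.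
have E x : M x 0 = v - M x 1.
  by rewrite -(sM x) !big_ord_recl big_ord0 [lift _ _](_ : _ = 1); [ring|apply/val_inj].
rewrite /cofactor !det_mx11 !mxE /mxtrace !big_ord_recl big_ord0 /=.
pose m a b := M (inord a) (inord b).
have mE (x y : 'I_2) : M x y = m x y by rewrite /m !inord_val.
move: (E 0) (E 1); rewrite !mE /= /bump /= !(exprD, expr0, expr1) => -> ->.
rewrite !(rmorphB, rmorphD, rmorphM) /= mulr0n mulr1n; ring.
Qed.

Lemma char_poly1 (R : comNzRingType) (M : 'M[R]_1) :
  char_poly M = 'X - (M 0 0)%:P.
Proof. by rewrite /char_poly det_mx11 !mxE eqxx mulr1n. Qed.

(** * Polynomial and generic conditions *)

Lemma continuous_complex (R : realType) (T : topologicalType) (f g : T -> R) :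
  continuous f -> continuous g ->
  continuous ((fun t => Complex (f t) (g t)) : T -> (R[i])^o).
Proof.
move=> cf cg t; apply/cvgrPdist_lt => e e0.
(* A positive element of [R[i]] has zero imaginary part. *)
have [r r0 re] : exists2 r : R, 0 < r & e = real_complex R r.
  move: e e0 => [x y]; rewrite ltcE /= => /andP[/eqP -> x0]; exact: (ex_intro2 _ _ x).
have r2 : 0 < r / 2 by rewrite divr_gt0.
have /cvgrPdist_lt /(_ _ r2) := cf t; have /cvgrPdist_lt /(_ _ r2) := cg t.
apply: filterS2 => s gs fs.
rewrite re normc_def ltcR /=.
rewrite -[ltRHS]gtr0_norm // -sqrtr_sqr ltr_sqrt ?exprn_gt0 //.
have sq (x : R) : `|x| < r / 2 -> x ^+ 2 < (r / 2) ^+ 2.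
  by move=> h; rewrite -real_normK ?num_real // ltr_pXn2r ?nnegrE ?normr_ge0 ?ltW.
apply: lt_le_trans (ltrD (sq _ fs) (sq _ gs)) _.
rewrite -subr_ge0 (_ : _ - _ = r ^+ 2 / 2); last by field.
by rewrite divr_ge0 ?sqr_ge0.
Qed.

(** Stated on values, so that closure under the ring operations provides the polynomials required by
    [generic] without writing them out. *)
Definition polynomial_fun (R : realType) n (g : 'rV[R]_n -> R) :=
  exists p : mpoly n R, forall a : 'rV[R]_n, meval (fun j => a 0 j) p = g a.

Section PolynomialFun.
Variables (R : realType) (n : nat).
Implicit Types g h : 'rV[R]_n -> R.

Lemma polynomial_fun_coord j : polynomial_fun (fun a : 'rV[R]_n => a 0 j).
Proof. by exists (mpolyX R (mnm1 j)) => a; rewrite mevalXU. Qed.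

Lemma polynomial_fun_cst (c : R) : polynomial_fun (fun _ : 'rV[R]_n => c).
Proof. by exists (mpolyC n c) => a; rewrite mevalC. Qed.

Lemma polynomial_funD g h :
  polynomial_fun g -> polynomial_fun h -> polynomial_fun (fun a => g a + h a).
Proof. by move=> [p pE] [q qE]; exists (p + q) => a; rewrite mevalD pE qE. Qed.

Lemma polynomial_funM g h :
  polynomial_fun g -> polynomial_fun h -> polynomial_fun (fun a => g a * h a).
Proof. by move=> [p pE] [q qE]; exists (p * q) => a; rewrite mevalM pE qE. Qed.

Lemma polynomial_funN g : polynomial_fun g -> polynomial_fun (fun a => - g a).
Proof. by move=> [p pE]; exists (- p) => a; rewrite mevalN pE. Qed.

Lemma polynomial_funB g h :
  polynomial_fun g -> polynomial_fun h -> polynomial_fun (fun a => g a - h a).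
Proof. by move=> pg ph; apply: polynomial_funD => //; apply: polynomial_funN. Qed.

Lemma polynomial_fun_sum I (r : seq I) (F : I -> 'rV[R]_n -> R) :
  (forall i, polynomial_fun (F i)) -> polynomial_fun (fun a => \sum_(i <- r) F i a).
Proof.
move=> pF; elim: r => [|i r IH].
  by exists 0 => a; rewrite big_nil meval0.
have [p pE] := polynomial_funD (pF i) IH.
by exists p => a; rewrite pE big_cons.
Qed.

Lemma continuous_polynomial_fun g : polynomial_fun g -> continuous g.
Proof.
move=> [p pE].
have -> : g = (fun a : 'rV[R]_n => meval (fun j => a 0 j) p) by apply/funext => a; rewrite pE.
have cX (m : multinom n) : continuous (fun b : 'rV[R]_n => \prod_i (b 0 i) ^+ (m i)).
  apply: (@continuous_big R _ *%R 1 xpredT (@mul_continuous R)) => i _ b.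
  apply: (@continuous_comp _ _ _ (fun b : 'rV[R]_n => b 0 i) (fun x => x ^+ m i)).
    exact: coord_continuous.
  exact: exprn_continuous.
elim/mpolyind: p {pE} => [|c m p _ _ IH] a.
  rewrite (_ : (fun _ => _) = fun _ : 'rV[R]_n => 0); first exact: cst_continuous.
  by apply/funext => b; rewrite meval0.
rewrite (_ : (fun _ => _) = (fun b : 'rV[R]_n => c) \*
     (fun b : 'rV[R]_n => \prod_i (b 0 i) ^+ (m i)) +
     (fun b : 'rV[R]_n => meval (fun j => b 0 j) p)); last first.
  by apply/funext => b; rewrite mevalD mevalZ mevalX.
apply: continuousD (IH a).
by apply: continuousM; [exact: cst_continuous|exact: cX].
Qed.

End PolynomialFun.

Section Generic.
Variables (R : realType) (k : nat).
Implicit Types P Q : cell_function R k -> Prop.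

Lemma generic_imp P Q : (forall f, P f -> Q f) -> generic P -> generic Q.
Proof.
move=> PQ [ps [ps0 psP]]; exists ps; split=> // f sf hf.
exact/PQ/psP.
Qed.

Lemma generic_and P Q : generic P -> generic Q -> generic (fun f => P f /\ Q f).
Proof.
move=> [ps [ps0 psP]] [qs [qs0 qsQ]]; exists (ps ++ qs); split.
  by rewrite all_cat ps0.
by move=> f sf; rewrite all_cat => /andP[hp hq]; split; [apply: psP|apply: qsQ].
Qed.

(** One point where the function does not vanish shows that its polynomial is nonzero, hence that
    the inequality is non-trivial. *)
Lemma generic_neq0 (g : 'rV[R]_k.+1 -> R) a :
  polynomial_fun g -> g a != 0 -> generic (fun f => g (partials f) != 0).
Proof.
move=> [p pE] ga; exists [:: p]; split=> /= [|f sf]; last by rewrite andbT pE.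
by rewrite andbT; apply: contra ga => /eqP p0; rewrite -pE p0 meval0.
Qed.

End Generic.

(** * Entries of the Jacobian as functions of the derivatives *)

Section Jacobian.
Variables (R : realType) (n k : nat) (N : network n k).
Implicit Type a : 'rV[R]_k.+1.

Lemma jacobianE a i j : jacobian N a i j =
  a 0 ord0 *+ (i == j) + \sum_(l < k) a 0 (lift ord0 l) * (N l i == j)%:R.
Proof.
rewrite /jacobian mxE mxE summxE; congr (_ + _).
by apply: eq_bigr => l _; rewrite !mxE.
Qed.

Lemma polynomial_fun_jacobian i j : polynomial_fun (fun a => jacobian N a i j).
Proof.
rewrite (_ : (fun _ => _) = fun a => a 0 ord0 * (i == j)%:R +
  \sum_(l < k) a 0 (lift ord0 l) * (N l i == j)%:R); last first.
  by apply/funext => a; rewrite jacobianE mulr_natr.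
apply: polynomial_funD.
  by apply: polynomial_funM; [exact: polynomial_fun_coord|exact: polynomial_fun_cst].
apply: polynomial_fun_sum => l.
by apply: polynomial_funM; [exact: polynomial_fun_coord|exact: polynomial_fun_cst].
Qed.

(** Each cell receives exactly one edge of each type, so the rows of every adjacency matrix sum to
    1. *)
Lemma jacobian_row_sum a i : \sum_j jacobian N a i j = \sum_j a 0 j.
Proof.
rewrite (eq_bigr _ (fun j _ => jacobianE a i j)) big_split big_ord_recl /=.
congr (_ + _).
  by rewrite (bigD1 i) //= eqxx mulr1n big1 ?addr0 // => j /negPf; rewrite eq_sym => ->.
rewrite exchange_big; apply: eq_bigr => l _ /=.
rewrite (bigD1 (N l i)) //= eqxx mulr1 big1 ?addr0 // => j /negPf.
by rewrite eq_sym => ->; rewrite mulr0.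
Qed.

End Jacobian.

(** * Annotations from a factored characteristic polynomial *)

Lemma continuous_real_complex (R : realType) n (g : 'rV[R]_n -> R) :
  polynomial_fun g -> continuous ((fun a => real_complex R (g a)) : 'rV[R]_n -> (R[i])^o).
Proof.
move=> pg; apply: continuous_complex; first exact: continuous_polynomial_fun.
exact: cst_continuous.
Qed.

(** The exponents add up to [n] by degree and the dimensions of the eigenspaces to at most [n], so
    no lower bound on a dimension can be strict. *)
Lemma decorates_repeated (R : realType) n (M : 'M[R[i]]_n) (L : seq (R[i] * nat)) :
  uniq [seq e.1 | e <- L] ->
  char_poly M = \prod_(e <- L) ('X - e.1%:P) ^+ e.2 ->
  {in L, forall e, (e.2 <= \rank (eigenspace M e.1))%N} ->
  {in L, forall e, decorates M e.1 (Repeated e.2)}.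
Proof.
move=> uL cM geL.
have nE : (\sum_(e <- L) e.2 = n)%N.
  apply/eqP; rewrite -eqSS -(size_char_poly M) cM eq_sym.
  elim: L {uL cM geL} => [|e L IH]; first by rewrite !big_nil size_poly1.
  rewrite !big_cons size_Mmonic ?monic_neq0 ?monic_exp ?monicXsubC ?monic_prod //.
    by rewrite size_exp_XsubC (eqP IH) addSn addnS.
  by move=> *; rewrite monic_exp ?monicXsubC.
have le_n : (\sum_(e <- L) \rank (eigenspace M e.1) <= \sum_(e <- L) e.2)%N.
  by rewrite nE -(big_map fst xpredT (fun z => \rank (eigenspace M z))) sum_rank_eigenspace.
move=> e eL; split; rewrite /alg_mult /geo_mult.
  rewrite cM {geL nE le_n}; elim: L uL {cM} eL => //= d L IH /andP[dL uL].
  have pn0 (K : seq (R[i] * nat)) : \prod_(e <- K) ('X - e.1%:P) ^+ e.2 != 0.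
    by rewrite monic_neq0 // monic_prod // => *; rewrite monic_exp ?monicXsubC.
  rewrite big_cons mupM ?pn0 ?monic_neq0 ?monic_exp ?monicXsubC // mup_XsubCX.
  rewrite inE => /predU1P[->|eL].
    rewrite eqxx mupNroot ?addn0 //; apply: contra dL.
    elim: L {IH uL} => [|e' L IH]; first by rewrite big_nil rootE hornerC oner_eq0.
    rewrite big_cons rootM inE => /orP[|/IH ->]; last by rewrite orbT.
    case: e'.2 => [|m]; first by rewrite rootE hornerC oner_eq0.
    by rewrite root_exp_XsubC eq_sym => ->.
  rewrite IH // (_ : d.1 == e.1 = false) //; apply: contraNF dL => /eqP ->.
  exact: map_f.
rewrite rank_eigenspaceT; apply/eqP; rewrite eqn_leq geL // andbT.
move: le_n; rewrite leqNgt; apply: contraNT; rewrite -ltnNge => lt.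
elim: L eL geL {uL cM nE} => //= d L IH; rewrite inE => dL geL; rewrite !big_cons.
have geL' : {in L, forall e, (e.2 <= \rank (eigenspace M e.1))%N}.
  by move=> x xL; rewrite geL ?inE ?xL ?orbT.
case/predU1P: dL => [<-|eL].
  rewrite -addSn leq_add // big_seq [leqRHS]big_seq; exact: leq_sum.
by rewrite -addnS leq_add ?IH ?geL ?mem_head.
Qed.

Lemma annotated_repeated (R : realType) n k (N : network n k)
    (L : seq (eigenfun R k * nat)) :
  all (fun e => 0 < e.2)%N L ->
  List.Forall (fun e => continuous (e.1 : 'rV[R]_k.+1 -> (R[i])^o)) L ->
  generic (fun f : cell_function R k => let a := partials f in
    [/\ uniq [seq e.1 a | e : eigenfun R k * nat <- L],
       char_poly (jacobianC N a) =
         \prod_(e <- L) ('X - ((e : eigenfun R k * nat).1 a)%:P) ^+ e.2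
     & List.Forall (fun e : eigenfun R k * nat =>
         e.2 <= \rank (eigenspace (jacobianC N a) (e.1 a)))%N L]) ->
  annotated_network N [seq (e.1, Repeated e.2) | e <- L].
Proof.
move=> L0 cL gL; split; [split|].
- rewrite -map_comp; apply/List.Forall_map; exact: cL.
- apply: generic_imp gL => f [uL cM geL]; rewrite -!map_comp; split => //.
  move=> z; rewrite eigenvalue_root_char cM.
  elim: L L0 {cL uL cM geL} => [|e L IH /= /andP[e0 L0]].
    by rewrite big_nil rootE hornerC oner_eq0.
  rewrite big_cons rootM inE IH //; congr orb.
  by rewrite -(prednK e0) root_exp_XsubC.
apply: generic_imp gL => f [uL cM geL]; apply/List.Forall_map.
pose F := [seq (e.1 (partials f), e.2) | e : eigenfun R k * nat <- L].
have dF : {in F, forall e, decorates (jacobianC N (partials f)) e.1 (Repeated e.2)}.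
  apply: decorates_repeated; rewrite -?map_comp ?big_map //.
  move=> e; rewrite /F; elim: geL => [|d L' gd _ IH]; first by rewrite in_nil.
  by rewrite map_cons inE => /predU1P[->|]; [exact: gd|exact: IH].
move: dF; rewrite /F; elim: L {L0 cL uL cM geL F} => // e L IH dF.
constructor; first by apply: (dF (_, _)); rewrite mem_head.
by apply: IH => x xL; apply: dF; rewrite /= inE xL orbT.
Qed.

(** With exponents 1, the bound on the eigenspaces only says that each root has an eigenvector. *)
Lemma annotated_simple (R : realType) n k (N : network n k) (L : seq (eigenfun R k)) :
  List.Forall (fun mu => continuous (mu : 'rV[R]_k.+1 -> (R[i])^o)) L ->
  (forall a, char_poly (jacobianC N a) = \prod_(mu <- L) ('X - ((mu : eigenfun R k) a)%:P)) ->
  generic (fun f : cell_function R k => uniq [seq mu (partials f) | mu : eigenfun R k <- L]) ->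
  annotated_network N [seq (mu, Repeated 1) | mu : eigenfun R k <- L].
Proof.
move=> cL cM gL.
rewrite (_ : map _ _ = [seq (e.1, Repeated e.2) | e <- [seq (mu, 1%N) | mu <- L]]); last first.
  by rewrite -map_comp.
apply: annotated_repeated; first by rewrite all_map all_predT.
  exact/List.Forall_map.
apply: generic_imp gL => f uL; split.
- by rewrite -map_comp.
- by rewrite big_map cM; apply: eq_bigr => mu _; rewrite expr1.
apply/List.Forall_map/List.Forall_forall => mu /= mL.
apply: rank_eigenspace_gt0; rewrite cM.
elim: L mL {cL cM uL} => //= nu L IH [->|mL]; rewrite big_cons rootM ?root_XsubC ?eqxx //.
by rewrite IH ?orbT.
Qed.

(* The determinant of the map induced by [M] on the quotient by the line of
   constant vectors, in the basis formed by the classes of e_i and e_j. *)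
Definition quot_det (R : comNzRingType) (M : 'M[R]_3) (i j c : 'I_3) : R :=
  (M i i - M c i) * (M j j - M c j) - (M i j - M c j) * (M j i - M c i).

(** The determinant of the induced map does not depend on the basis of the quotient. *)
Lemma quot_det_indep (R : comNzRingType) (M : 'M[R]_3) v (i j c : 'I_3) :
  (forall x, \sum_y M x y = v) -> uniq [:: i; j; c] ->
  quot_det M i j c = quot_det M 1 2 0.
Proof.
move=> sM.
have E x : M x 0 = v - M x 1 - M x 2.
  by rewrite -(sM x) (@big_ord3 _ 0 1 2) //; ring.
rewrite /quot_det.
by case: (ord3P i) (ord3P j) (ord3P c) => -> [] -> [] -> //= _; rewrite ?E; ring.
Qed.

Lemma quot_det_map (R S : comNzRingType) (g : {rmorphism R -> S}) (M : 'M[R]_3) i j c :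
  quot_det (map_mx g M) i j c = g (quot_det M i j c).
Proof. by rewrite /quot_det !mxE !(rmorphB, rmorphM). Qed.

(** The right-hand side is the trace of the induced map in the basis formed by the classes of e_c
    and e_j. *)
Lemma quot_trace (R : comNzRingType) (M : 'M[R]_3) v (i j c : 'I_3) :
  (forall x, \sum_y M x y = v) -> uniq [:: i; j; c] ->
  \tr M - v = (M c c - M i c) + (M j j - M i j).
Proof.
move=> sM u; rewrite /mxtrace (big_ord3 _ u) -(sM i) (big_ord3 _ u); ring.
Qed.

Lemma rank_equal_rows (F : fieldType) m n (A : 'M[F]_(m, n)) :
  (forall i i' j, A i j = A i' j) -> (\rank A <= 1)%N.
Proof.
case: m A => [|m] A eA; first by rewrite (leq_trans (rank_leq_row A)).
rewrite (_ : A = const_mx 1 *m row 0 A); last first.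
  by apply/matrixP => i j; rewrite !mxE big_ord1 !mxE mul1r; apply: eA.
by rewrite (leq_trans (mulmx_max_rank _ _)).
Qed.

Lemma rank_one_row (F : fieldType) m n (A : 'M[F]_(m, n)) (c : 'I_m) :
  (forall i j, i != c -> A i j = 0) -> (\rank A <= 1)%N.
Proof.
move=> A0; rewrite (_ : A = delta_mx c 0 *m row c A); last first.
  apply/matrixP => i j; rewrite !mxE big_ord1 !mxE eqxx andbT.
  by case: eqVneq => [->|/A0 ->]; rewrite (mul1r, mul0r).
by rewrite (leq_trans (mulmx_max_rank _ _)).
Qed.

(** * Eigenspaces when the induced map has a double eigenvalue *)

Section Defective.
Variables (F : fieldType) (M : 'M[F]_3) (v mu : F).
Hypothesis sM : forall x, \sum_y M x y = v.
Hypotheses (tM : \tr M - v = mu + mu) (dM : quot_det M 1 2 0 = mu * mu).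
Hypothesis vmu : v != mu.

(** Otherwise [M - v] has rank at most 1, so the map it induces on the two-dimensional quotient is
    singular and [v] is a root of (X - mu)^2. *)
Lemma rank_eigenspace_valency : (\rank (eigenspace M v) <= 1)%N.
Proof.
rewrite rank_eigenspace leqNgt; apply: contra vmu => r1.
have {r1} r1 : (\rank (M - v%:M)%R <= 1)%N by move: r1; case: (\rank _) => [|[|[|]]].
pose A := M - v%:M.
have d0 : quot_det A 1 2 0 = 0.
  rewrite /quot_det.
  rewrite mulrBl !mulrBr !mulrBl (minors_eq0 1 2 1 2 r1).
  by rewrite (minors_eq0 1 0 1 2 r1) (minors_eq0 0 2 1 2 r1); ring.
suff : (v - mu) ^+ 2 = 0 by move/eqP; rewrite expf_eq0 /= subr_eq0.
(* This ordering uses the same basis as [quot_det M 1 2 0]. *)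
have T := quot_trace sM (isT : uniq [:: 0; 2; 1 : 'I_3]).
move: d0 dM T; rewrite tM /quot_det !mxE /= !(mulr0n, mulr1n) !subr0 => d0 d1 T.
rewrite -[RHS]d0 (_ : _ ^+ 2 = v ^+ 2 - (mu + mu) * v + mu * mu); last by ring.
by rewrite -d1 T; ring.
Qed.

(** Otherwise [M - mu] has rank at most 1 and rows of equal nonzero sum, so its rows coincide; off
    the diagonal these are entries of [M]. *)
Lemma rank_eigenspace_defective i i' j : i != j -> i' != j -> M i j != M i' j ->
  (\rank (eigenspace M mu) <= 1)%N.
Proof.
move=> ij i'j; apply: contraR; rewrite rank_eigenspace -ltnNge => r1.
have {r1} r1 : (\rank (M - mu%:M)%R <= 1)%N by move: r1; case: (\rank _) => [|[|[|]]].
have sA x : \sum_y (M - mu%:M) x y = v - mu.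
  rewrite (eq_bigr (fun y => M x y - mu *+ (x == y))) => [|y _]; last by rewrite !mxE.
  rewrite sumrB sM; congr (_ - _).
  by rewrite (bigD1 x) //= eqxx big1 ?addr0 // => y /negPf; rewrite eq_sym => ->.
have := rank1_rows r1 sA _ i i' j; rewrite subr_eq0 => /(_ vmu).
by rewrite !mxE (negPf ij) (negPf i'j) !subr0 => ->.
Qed.

End Defective.

(** * Three-cell networks *)

Lemma uniq3E (T : eqType) (x y z : T) :
  uniq [:: x; y; z] = [&& x != y, x != z & y != z].
Proof. by rewrite /= !inE negb_or andbT -andbA. Qed.

Lemma ord3_pair (c : 'I_3) : exists i j, uniq [:: i; j; c].
Proof. by case: (ord3P c) => ->; [exists 1, 2|exists 0, 2|exists 0, 1]. Qed.

Lemma ord3_third (c c' : 'I_3) : c != c' -> exists i, uniq [:: i; c'; c].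
Proof.
by case: (ord3P c) (ord3P c') => -> [] -> // _;
  [exists 2|exists 1|exists 2|exists 0|exists 1|exists 0].
Qed.

Lemma uniq3_other (i j c x : 'I_3) : uniq [:: i; j; c] -> x != c -> x = i \/ x = j.
Proof.
by case: (ord3P i) (ord3P j) (ord3P c) (ord3P x) => -> [] -> [] -> [] -> //; auto.
Qed.

(* The partition {{c}, complement of c} is balanced. *)
Definition balanced n k (N : network n k) (c : 'I_n) : bool :=
  [forall l, forall i, forall j,
     (i != c) ==> (j != c) ==> ((N l i == c) == (N l j == c))].

Lemma balancedP n k (N : network n k) c :
  reflect (forall l i j, i != c -> j != c -> (N l i == c) = (N l j == c))
          (balanced N c).
Proof.
apply: (iffP forallP) => [H l i j ic jc|H l].
  by move: (H l) => /forallP/(_ i)/forallP/(_ j); rewrite ic jc => /eqP.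
apply/forallP => i; apply/forallP => j.
by apply/implyP => ic; apply/implyP => jc; rewrite (H l i j).
Qed.

Lemma jacobian_delta (R : realType) n k (N : network n k) l x y :
  jacobian N (delta_mx 0 (lift ord0 l)) x y = (N l x == y)%:R :> R.
Proof.
rewrite jacobianE mxE eqxx (negPf (neq_lift _ _)) mul0rn add0r.
rewrite (bigD1 l) //= mxE !eqxx mul1r big1 ?addr0 // => l' ll'.
by rewrite mxE eqxx (inj_eq lift_inj) (negPf ll') mul0r.
Qed.

(** The difference of the two entries is linear in [a], and its coefficient at each edge type
    compares the edges from [c]; unit vectors isolate these coefficients. *)
Lemma balanced_jacobian (R : realType) n k (N : network n k) c :
  balanced N c <-> forall (a : 'rV[R]_k.+1) i j, i != c -> j != c ->
    jacobian N a i c = jacobian N a j c.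
Proof.
split=> [/balancedP b a i j ic jc|H].
  rewrite !jacobianE (negPf ic) (negPf jc); congr (_ + _).
  by apply: eq_bigr => l _; rewrite (b l i j).
apply/balancedP => l i j ic jc.
have := H (delta_mx 0 (lift ord0 l)) i j ic jc.
rewrite !jacobian_delta.
case: (N l i == c); case: (N l j == c) => //= /eqP; rewrite ?oner_eq0 //.
by rewrite eq_sym oner_eq0.
Qed.

(** * Spectrum of the map induced on the quotient by the diagonal *)

Section ThreeCells.
Variables (R : realType) (k : nat) (N : network 3 k).
Implicit Type a : 'rV[R]_k.+1.

Let J a := jacobian N a.
Definition rvalency a : R := \sum_j a 0 j.
(* Trace, determinant and discriminant of the map induced by the Jacobian on the
   quotient by the diagonal; [qchar] is its characteristic polynomial at the
   valency. *)
Definition qtrace a : R := \tr (jacobian N a) - rvalency a.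
Definition qdet a : R := quot_det (jacobian N a) 1 2 0.
Definition qchar a : R := rvalency a ^+ 2 - qtrace a * rvalency a + qdet a.
Definition qdisc a : R := qtrace a ^+ 2 - 4 * qdet a.
(* If [c] is balanced, the eigenvalue other than the valency of the restriction
   to the synchrony subspace isolating [c]; the choice of [c + 1] (addition modulo
   3) among the cells distinct from [c] is then irrelevant. *)
Definition syn_ev c a : R := jacobian N a c c - jacobian N a (c + 1) c.

Let sJ a x : \sum_y J a x y = rvalency a.
Proof. exact: jacobian_row_sum. Qed.

Lemma qtraceE i j c a : uniq [:: i; j; c] ->
  qtrace a = (J a c c - J a i c) + (J a j j - J a i j).
Proof. by move=> u; rewrite /qtrace (quot_trace (sJ a) u). Qed.

Lemma qdetE i j c a : uniq [:: i; j; c] -> qdet a = quot_det (J a) i j c.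
Proof. by move=> u; rewrite (quot_det_indep (sJ a) u). Qed.

Lemma syn_evE c i a : balanced N c -> i != c -> syn_ev c a = J a c c - J a i c.
Proof.
move=> /balanced_jacobian b ic; congr (_ - _); apply: b => //.
by case: (ord3P c) => ->.
Qed.

(** If [c] is balanced, the class of e_c is an eigenvector of the induced map for [syn_ev c], and
    the trace gives the other eigenvalue. *)
Lemma syn_ev_root c a : balanced N c ->
  qdet a = syn_ev c a * (qtrace a - syn_ev c a).
Proof.
move=> b; have [i [j u]] := ord3_pair c.
have /and3P[ij ic jc] : [&& i != j, i != c & j != c] by rewrite -uniq3E.
(* In the basis of the classes of e_c and e_j the induced map is triangular. *)
have u' : uniq [:: c; j; i] by rewrite uniq3E ![c == _]eq_sym [j == i]eq_sym ij ic jc.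
rewrite (qdetE a u') (qtraceE a u) (syn_evE a b ic) /quot_det.
by move: (b) => /(@balanced_jacobian R) /(_ a _ _ jc ic) ->; ring.
Qed.

(** The classes of e_c and e_c' are two independent eigenvectors of the induced map. *)
Lemma qtrace_syn_ev c c' a : c != c' -> balanced N c -> balanced N c' ->
  qtrace a = syn_ev c a + syn_ev c' a.
Proof.
move=> cc' b b'; have [i u] := ord3_third cc'.
have /and3P[ic' ic c'c] : [&& i != c', i != c & c' != c] by rewrite -uniq3E.
by rewrite (qtraceE a u) (syn_evE a b ic) (syn_evE a b' ic').
Qed.

(* If a map of the plane has two invariant lines and a double eigenvalue, it is
   scalar, and every line is invariant. *)
Lemma balanced_third c c' i : uniq [:: i; c'; c] -> balanced N c -> balanced N c' ->
  (forall a, qdisc a = 0) -> balanced N i.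
Proof.
move=> u b b' d0; apply/(@balanced_jacobian R).
have /and3P[ic' ic c'c] : [&& i != c', i != c & c' != c] by rewrite -uniq3E.
have cc' : c != c' by rewrite eq_sym.
have JE a : J a c i = J a c' i.
  have T := qtrace_syn_ev a cc' b b'.
  have D := syn_ev_root a b.
  (* The discriminant is the square of the difference of the two eigenvalues. *)
  have E : syn_ev c a = syn_ev c' a.
    apply/eqP; rewrite -subr_eq0 -sqrf_eq0; apply/eqP; rewrite -(d0 a) /qdisc D T; ring.
  move: E; rewrite (syn_evE a b ic) (syn_evE a b' ic').
  (* Rows [c] and [c'] have the same sum; balance and the equal eigenvalues cancel all entries but
     those of column [i]. *)
  have := sJ a c; have := sJ a c'; rewrite !(big_ord3 _ u).
  have /(@balanced_jacobian R) /(_ a c' i c'c ic) := b.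
  have /(@balanced_jacobian R) /(_ a c i cc' ic') := b'.
  by rewrite -/(J a) => e1 e2 h1 h2 h3; lra.
have u' : uniq [:: c; c'; i] by rewrite uniq3E cc' ![_ == i]eq_sym ic ic'.
move=> a x y xi yi.
by case: (uniq3_other u' xi) (uniq3_other u' yi) => -> [] ->.
Qed.

Lemma polynomial_fun_rvalency : polynomial_fun rvalency.
Proof. by apply: polynomial_fun_sum => j; apply: polynomial_fun_coord. Qed.

Lemma polynomial_fun_qtrace : polynomial_fun qtrace.
Proof.
apply: polynomial_funB; last exact: polynomial_fun_rvalency.
by apply: polynomial_fun_sum => i; apply: polynomial_fun_jacobian.
Qed.

Lemma polynomial_fun_qdet : polynomial_fun qdet.
Proof.
by apply: polynomial_funB; apply: polynomial_funM;
  apply: polynomial_funB; apply: polynomial_fun_jacobian.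
Qed.

Lemma polynomial_fun_qchar : polynomial_fun qchar.
Proof.
apply: polynomial_funD; last exact: polynomial_fun_qdet.
apply: polynomial_funB; apply: polynomial_funM;
  by [exact: polynomial_fun_rvalency|exact: polynomial_fun_qtrace].
Qed.

Lemma polynomial_fun_qdisc : polynomial_fun qdisc.
Proof.
apply: polynomial_funB; apply: polynomial_funM;
  by [exact: polynomial_fun_qtrace|exact: polynomial_fun_cst|exact: polynomial_fun_qdet].
Qed.

Lemma polynomial_fun_syn_ev c : polynomial_fun (syn_ev c).
Proof. by apply: polynomial_funB; apply: polynomial_fun_jacobian. Qed.

Let v : eigenfun R k := @valency R k.

Lemma continuous_valency : continuous (v : 'rV[R]_k.+1 -> (R[i])^o).
Proof. exact/continuous_real_complex/polynomial_fun_rvalency. Qed.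

(** The roots enter only through their sum and product, so real and complex eigenvalues are treated
    alike. *)
Lemma char_poly_jacobianC a (m1 m2 : R[i]) :
  m1 + m2 = real_complex R (qtrace a) -> m1 * m2 = real_complex R (qdet a) ->
  char_poly (jacobianC N a) = ('X - (v a)%:P) * (('X - m1%:P) * ('X - m2%:P)).
Proof.
move=> T D; rewrite /jacobianC -map_char_poly.
rewrite (char_poly_row_sum3 (isT : uniq [:: 1; 2; 0 : 'I_3]) (sJ a)).
rewrite -/(quot_det (J a) 1 2 0) -/(qdet a) -/(qtrace a).
move: (qdet a) (qtrace a) D T => d t D T.
rewrite !(rmorphM, rmorphB, rmorphD) /= ?map_polyXn map_polyZ !map_polyC !map_polyX /=.
rewrite -T -D -mul_polyC !(rmorphM, rmorphD) /=; ring.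
Qed.
End ThreeCells.

(** * Annotations of the top *)

Section TopAnnotation.
Variables (R : realType) (k : nat) (N : network 3 k).
Implicit Types a : 'rV[R]_k.+1.

Let v : eigenfun R k := @valency R k.
Local Notation rc := (real_complex R).
Let sJ a x : \sum_y jacobian N a x y = rvalency a.
Proof. exact: jacobian_row_sum. Qed.

Hypothesis qchar_neq0 : exists a, qchar N a != 0.

Lemma generic_qchar : generic (fun f : cell_function R k => qchar N (partials f) != 0).
Proof. by have [a qa] := qchar_neq0; exact: generic_neq0 (polynomial_fun_qchar R N) qa. Qed.

Lemma qcharE a (m1 m2 : R[i]) : m1 + m2 = rc (qtrace N a) -> m1 * m2 = rc (qdet N a) ->
  rc (qchar N a) = (v a - m1) * (v a - m2).
Proof.
rewrite /qchar; move: (qtrace N a) (qdet N a) => t d T D.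
by rewrite !(rmorphD, rmorphN, rmorphM) /= -T -D -/(v a); ring.
Qed.

Lemma valency_neq_eigen a (m1 m2 : R[i]) : m1 + m2 = rc (qtrace N a) ->
  m1 * m2 = rc (qdet N a) -> qchar N a != 0 -> (v a != m1) && (v a != m2).
Proof.
move=> T D; apply: contraR; rewrite -(inj_eq (@complexI R)) (qcharE T D) rmorph0.
by rewrite mulf_eq0 !subr_eq0 negb_and !negbK.
Qed.

(** A nonzero [qchar] separates the valency from [m1] and [m2], and a nonzero [qdisc], being (m1 -
    m2)^2, separates these two. *)
Lemma annotated_top_simple (m1 m2 : eigenfun R k) :
  continuous (m1 : 'rV[R]_k.+1 -> (R[i])^o) ->
  continuous (m2 : 'rV[R]_k.+1 -> (R[i])^o) ->
  (forall a, m1 a + m2 a = rc (qtrace N a)) ->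
  (forall a, m1 a * m2 a = rc (qdet N a)) ->
  (exists a, qdisc N a != 0) ->
  annotated_network N [:: (v, Repeated 1); (m1, Repeated 1); (m2, Repeated 1)].
Proof.
move=> c1 c2 T D [b db].
apply: (@annotated_simple R 3 k N [:: v; m1; m2]).
- by apply: List.Forall_cons; [exact: continuous_valency|do !apply: List.Forall_cons].
- by move=> a; rewrite !big_cons big_nil mulr1 (char_poly_jacobianC (T a) (D a)).
have gd := generic_neq0 (polynomial_fun_qdisc R N) db.
apply: generic_imp (generic_and generic_qchar gd) => f [fq fd] /=.
have /andP[vm1 vm2] := valency_neq_eigen (T _) (D _) fq.
rewrite !inE negb_or vm1 vm2 !andbT /=; apply: contra fd => /eqP m12.
rewrite -(inj_eq (@complexI R)) /qdisc.
move: (T (partials f)) (D (partials f)); rewrite -m12.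
move: (qtrace _ _) (qdet _ _) => t d T' D'.
rewrite mulr_natl expr2 rmorphB rmorphM rmorphMn /=.
by rewrite -T' -D'; apply/eqP; ring.
Qed.

(** In each column the off-diagonal entries agree and the diagonal one exceeds them by [m]. So
    [J - m] has equal rows and rank at most 1. *)
Lemma annotated_top_double (m : 'rV[R]_k.+1 -> R) :
  polynomial_fun m ->
  (forall a, qtrace N a = m a + m a) -> (forall a, qdet N a = m a * m a) ->
  (forall a i i' j, i != j -> i' != j -> jacobian N a i j = jacobian N a i' j) ->
  (forall a c, m a = syn_ev N c a) ->
  annotated_network N [:: (v, Repeated 1); (rc \o m, Repeated 2)].
Proof.
move=> pm T D eqJ mE.
have T' a : rc (m a) + rc (m a) = rc (qtrace N a) by rewrite T rmorphD.
have D' a : rc (m a) * rc (m a) = rc (qdet N a) by rewrite D rmorphM.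
apply: (@annotated_repeated R 3 k N [:: (v, 1%N); (rc \o m, 2%N)]) => //.
  apply: List.Forall_cons; first exact: continuous_valency.
  by apply: List.Forall_cons => //; exact: continuous_real_complex.
apply: generic_imp generic_qchar => f fq.
have /andP[vm _] := valency_neq_eigen (T' _) (D' _) fq.
have C := char_poly_jacobianC (T' (partials f)) (D' (partials f)).
split; first by rewrite /= inE vm.
  by rewrite !big_cons big_nil mulr1 C expr1 expr2.
apply: List.Forall_cons; last apply: List.Forall_cons => //=.
  by apply: rank_eigenspace_gt0; rewrite C rootM root_XsubC eqxx.
rewrite rank_eigenspace.
suff: (\rank (jacobianC N (partials f) - (rc (m (partials f)))%:M)%R <= 1)%N.
  by case: (\rank _) => [|[]].
apply: rank_equal_rows => i i' j.
have mJ x y : x != y ->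
    m (partials f) = jacobian N (partials f) y y - jacobian N (partials f) x y.
  move=> xy; rewrite (mE _ y); congr (_ - _); apply: eqJ => //.
  by case: (ord3P y) => ->.
(* Here [y + 1] merely names some cell other than [y]. *)
have H x y : (jacobianC N (partials f) - (rc (m (partials f)))%:M) x y
     = rc (jacobian N (partials f) (y + 1) y).
  have -> : (jacobianC N (partials f) - (rc (m (partials f)))%:M) x y =
    rc (jacobian N (partials f) x y) - rc (m (partials f)) *+ (x == y) by rewrite !mxE.
  case: eqVneq => [->|xy]; last by rewrite subr0 (eqJ _ x (y + 1) y) //; case: (ord3P y) => ->.
  by rewrite mulr1n (mJ (y + 1) y) ?rmorphB ?subKr //; case: (ord3P y) => ->.
by rewrite !H.
Qed.

(** An unbalanced cell yields two off-diagonal entries of one column that differ generically, which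
    rules out a two-dimensional eigenspace for [m]. *)
Lemma annotated_top_star (m : 'rV[R]_k.+1 -> R) c :
  polynomial_fun m ->
  (forall a, qtrace N a = m a + m a) -> (forall a, qdet N a = m a * m a) ->
  ~~ balanced N c ->
  annotated_network N [:: (v, Repeated 1); (rc \o m, Starred)].
Proof.
move=> pm T D nb.
have T' a : rc (m a) + rc (m a) = rc (qtrace N a) by rewrite T rmorphD.
have D' a : rc (m a) * rc (m a) = rc (qdet N a) by rewrite D rmorphM.
have [b [i [j [ic jc bJ]]]] : exists b i j, [/\ i != c, j != c &
    jacobian N (b : 'rV[R]_k.+1) i c - jacobian N b j c != 0].
  apply: contrapT => H; move/negP: nb; apply; apply/(@balanced_jacobian R) => a i j ic jc.
  apply: contrapT => /eqP; rewrite -subr_eq0 => h; apply: H.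
  by exists a, i, j.
have gJ := generic_neq0 (polynomial_funB (polynomial_fun_jacobian R N i c)
  (polynomial_fun_jacobian R N j c)) bJ.
split; [split|].
- apply: List.Forall_cons; first exact: continuous_valency.
  by apply: List.Forall_cons => //; exact: continuous_real_complex.
- apply: generic_imp generic_qchar => f fq.
  have /andP[vm _] := valency_neq_eigen (T' _) (D' _) fq.
  split=> [|z]; first by rewrite /= inE vm.
  rewrite eigenvalue_root_char (char_poly_jacobianC (T' _) (D' _)).
  by rewrite !rootM !root_XsubC orbb !inE.
apply: generic_imp (generic_and generic_qchar gJ) => f [fq fJ].
set a := partials f; set M := jacobianC N a.
have /andP[vm _] := valency_neq_eigen (T' a) (D' a) fq.
have C := char_poly_jacobianC (T' a) (D' a).
have sM x : \sum_y M x y = v a.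
  by under eq_bigr do rewrite mxE; rewrite -rmorph_sum sJ.
have tM : \tr M - v a = rc (m a) + rc (m a).
  by rewrite T' /qtrace rmorphB /= -trace_map_mx.
have dM : quot_det M 1 2 0 = rc (m a) * rc (m a).
  by rewrite D' /M /jacobianC (quot_det_map (real_complex R)).
have aC z : alg_mult M z = count_mem z [:: v a; rc (m a); rc (m a)].
  by rewrite /alg_mult C -mup_prod_XsubC !big_cons big_nil mulr1.
have g1 z : z \in [:: v a; rc (m a)] -> (0 < \rank (eigenspace M z))%N.
  move=> zs; apply: rank_eigenspace_gt0; rewrite C !rootM !root_XsubC orbb.
  by move: zs; rewrite !inE.
have dv : decorates M (v a) (Repeated 1).
  split; first by rewrite aC /= eqxx eq_sym (negPf vm).
  apply/eqP; rewrite /geo_mult rank_eigenspaceT eqn_leq g1 ?mem_head // andbT.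
  exact: (rank_eigenspace_valency sM tM dM vm).
have dm : decorates M (rc (m a)) Starred.
  split; first by rewrite aC /= eqxx (negPf vm).
  apply/eqP; rewrite /geo_mult rank_eigenspaceT eqn_leq g1 ?inE ?eqxx ?orbT // andbT.
  apply: (rank_eigenspace_defective sM vm ic jc).
  have E x y : M x y = rc (jacobian N a x y) by rewrite mxE.
  by rewrite !E (inj_eq (@complexI R)) -subr_eq0.
apply: List.Forall_cons; first exact: dv.
by apply: List.Forall_cons; [exact: dm|exact: List.Forall_nil].
Qed.

End TopAnnotation.

(** * Networks where two cells receive only from themselves *)

Section TwoRoots.
Variables (R : realType) (k : nat) (N : network 3 k).
Variables i j c : 'I_3.
Hypotheses (u : uniq [:: i; j; c]) (Ni : forall l, N l i = i) (Nj : forall l, N l j = j).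
Implicit Types a : 'rV[R]_k.+1.
Let v : eigenfun R k := @valency R k.

Lemma jacobian_root a x y : (forall l, N l x = x) ->
  jacobian N a x y = rvalency a *+ (x == y).
Proof.
move=> Nx; rewrite jacobianE /rvalency big_ord_recl mulrnDl; congr (_ + _).
rewrite -sumrMnl; apply: eq_bigr => l _; rewrite Nx.
by case: (x == y); rewrite ?mulr1 ?mulr0 ?mulr0n.
Qed.

Lemma two_roots_balanced : balanced N c.
Proof.
apply/balancedP => l; move: u; rewrite uniq3E => /and3P[ij ic jc] x y xc yc.
suff F z : z != c -> (N l z == c) = false by rewrite !F.
by move/(uniq3_other u) => [] ->; rewrite (Ni, Nj) (negPf ic, negPf jc).
Qed.

(** Only row [c] of [J - v] can be nonzero, so the eigenspace of the valency has dimension at least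
    2. *)
Lemma annotated_two_roots : (exists a, rvalency a - syn_ev N c a != 0) ->
  annotated_network N [:: (v, Repeated 2); (real_complex R \o syn_ev N c, Repeated 1)].
Proof.
move=> [b vm]; move: u; rewrite uniq3E => /and3P[ij ic jc].
have E a : syn_ev N c a = jacobian N a c c.
  by rewrite (syn_evE a two_roots_balanced ic) (jacobian_root _ _ Ni) (negPf ic) subr0.
have T a : qtrace N a = rvalency a + syn_ev N c a.
  rewrite (qtraceE _ a u) E !(jacobian_root _ _ Ni) !(jacobian_root _ _ Nj).
  by rewrite (negPf ic) (negPf ij) eqxx !subr0 mulr1n addrC.
have D a : qdet N a = rvalency a * syn_ev N c a.
  by rewrite (syn_ev_root a two_roots_balanced) T addrK mulrC.
have gv := generic_neq0 (polynomial_funB (polynomial_fun_rvalency R k)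
  (polynomial_fun_syn_ev R N c)) vm.
apply: (@annotated_repeated R 3 k N [:: (v, 2%N); (real_complex R \o syn_ev N c, 1%N)]) => //.
  apply: List.Forall_cons; first exact: continuous_valency.
  by apply: List.Forall_cons => //; exact/continuous_real_complex/polynomial_fun_syn_ev.
apply: generic_imp gv => f fv.
set a := partials f in fv *.
have C : char_poly (jacobianC N a) = ('X - (v a)%:P) *
   (('X - (v a)%:P) * ('X - (real_complex R (syn_ev N c a))%:P)).
  by apply: char_poly_jacobianC; [rewrite T [RHS]rmorphD|rewrite D [RHS]rmorphM].
split.
- by rewrite /= inE andbT (inj_eq (@complexI R)) -subr_eq0.
- by rewrite !big_cons big_nil mulr1 C expr1 expr2 mulrA.
apply: List.Forall_cons; last apply: List.Forall_cons => //=; last first.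
  by apply: rank_eigenspace_gt0; rewrite C !rootM !root_XsubC eqxx !orbT.
rewrite rank_eigenspace; suff: (\rank (jacobianC N a - (v a)%:M)%R <= 1)%N.
  by case: (\rank _) => [|[]].
apply: (@rank_one_row _ _ _ _ c) => x y xc.
have Nx l : N l x = x.
  by have [->|->] := uniq3_other u xc.
have -> : (jacobianC N a - (v a)%:M) x y = real_complex R (jacobian N a x y) - v a *+ (x == y).
  by rewrite !mxE.
by rewrite (jacobian_root _ _ Nx) rmorphMn subrr.
Qed.

End TwoRoots.

(** * Synchrony subspaces *)

(** Cell 1 stands for the class of [c], cell 0 for the two other cells, represented by [c + 1]; this
    is a quotient of [N] when [c] is balanced. *)
Definition two_cell_quotient k (N : network 3 k) (c : 'I_3) : network 2 k :=
  fun l b => if N l (if b == 1 then c else c + 1) == c then 1 else 0.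

Section Subspaces.
Variable R : realType.
Implicit Types (D : {vspace 'cV[R]_3}) (x : 'cV[R]_3).

(** The plane where the two cells other than [c] are synchronous. *)
Definition pair_sync (c : 'I_3) : {vspace 'cV[R]_3} :=
  (full_synchrony R 3 + <[(delta_mx c 0)%R]>)%VS.

Lemma mem_full_synchrony n (x : 'cV[R]_n) :
  x \in full_synchrony R n <-> forall i j, x i 0 = x j 0.
Proof.
split=> [/vlineP[r ->] i j|h]; first by rewrite !mxE.
apply/vlineP; case: n x h => [|n] x h.
  by exists 0; apply/matrixP => -[].
by exists (x 0 0); apply/matrixP => i j; rewrite !mxE ord1 mulr1.
Qed.

Lemma mem_pair_sync c x :
  x \in pair_sync c <-> forall i j, i != c -> j != c -> x i 0 = x j 0.
Proof.
split=> [/memv_addP[y /mem_full_synchrony hy [_ /vlineP[r ->] ->]] i j ic jc|h].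
  by rewrite !mxE (negPf ic) (negPf jc) (hy i j).
have [i [j u]] := ord3_pair c.
have /and3P[ij ic jc] : [&& i != j, i != c & j != c] by rewrite -uniq3E.
apply/memv_addP; exists (x i 0 *: const_mx 1).
  by apply/mem_full_synchrony => *; rewrite !mxE.
exists ((x c 0 - x i 0) *: delta_mx c 0); first exact/memvZ/memv_line.
apply/matrixP => y z; rewrite !mxE ord1 eqxx andbT mulr1.
by case: eqVneq => [->|yc]; rewrite ?mulr1 ?subrKC // mulr0 addr0 (h y i).
Qed.

Lemma dim_pair_sync c : \dim (pair_sync c) = 2%N.
Proof.
have [i [j u]] := ord3_pair c.
have /and3P[ij ic jc] : [&& i != j, i != c & j != c] by rewrite -uniq3E.
rewrite dimv_disjoint_sum ?dim_vline.
  have -> : const_mx 1 != 0 :> 'cV[R]_3.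
    by apply/eqP => /matrixP/(_ 0 0)/eqP; rewrite !mxE oner_eq0.
  have -> // : delta_mx c 0 != 0 :> 'cV[R]_3.
  by apply/eqP => /matrixP/(_ c 0)/eqP; rewrite !mxE !eqxx oner_eq0.
apply/eqP; rewrite -subv0; apply/subvP => x; rewrite memv_cap memv0.
move=> /andP[/mem_full_synchrony h /vlineP[r rE]].
have r0 : r = 0 by move: (h c i); rewrite rE !mxE (negPf ic) !eqxx mulr1 mulr0.
by rewrite rE r0 scale0r.
Qed.

Lemma pair_sync_sub c c' : (pair_sync c <= pair_sync c')%VS -> c = c'.
Proof.
move=> /subvP/(_ (delta_mx c 0)) h; apply/eqP; apply: contraT => cc'.
have [i u] : exists i, uniq [:: i; c; c'] by apply: ord3_third; rewrite eq_sym.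
have /and3P[ic ic' _] : [&& i != c, i != c' & c != c'] by rewrite -uniq3E.
have /h /mem_pair_sync/(_ _ _ ic' cc')/eqP : delta_mx c 0 \in pair_sync c.
  by apply/mem_pair_sync => x y xc yc; rewrite !mxE (negPf xc) (negPf yc).
by rewrite !mxE (negPf ic) !eqxx eq_sym oner_eq0.
Qed.

Lemma polydiagonal_pair_sync c : polydiagonal (pair_sync c).
Proof.
exists [set ij | (ij.1 != c) && (ij.2 != c)] => x.
split=> [/mem_pair_sync h i j|h]; first by rewrite inE => /andP[]; apply: h.
by apply/mem_pair_sync => i j ic jc; apply: h; rewrite inE ic jc.
Qed.

Lemma polydiagonal_full_synchrony n : polydiagonal (full_synchrony R n).
Proof.
exists finset.setT => x; split=> [/mem_full_synchrony h i j _ //|h].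
by apply/mem_full_synchrony => i j; apply: h; rewrite finset.in_setT.
Qed.

Lemma polydiagonal_fullv n : polydiagonal (fullv : {vspace 'cV[R]_n}).
Proof. by exists finset.set0 => x; split=> [_ i j|_]; rewrite ?finset.in_set0 ?memvf. Qed.

(** Only the pairs of cells that are equated matter: two or more pairs give full synchrony, one pair
    gives a plane, none the whole space. *)
Lemma polydiagonal3P D : polydiagonal D ->
  [\/ D = full_synchrony R 3, D = fullv | exists c, D = pair_sync c].
Proof.
move=> [E DE]; pose e i j := ((i, j) \in E) || ((j, i) \in E).
have De x : x \in D <-> [/\ e 1 2 -> x 1 0 = x 2 0, e 0 2 -> x 0 0 = x 2 0 &
    e 0 1 -> x 0 0 = x 1 0].
  rewrite DE; split=> [h|[h0 h1 h2] i j].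
    by split=> /orP[] /h.
  have sym y z : (y, z) \in E -> e y z /\ e z y by rewrite /e => ->; rewrite orbT.
  case: (ord3P i) (ord3P j) => -> [] -> // /sym[e1 e2];
    by [exact: h0|exact: h1|exact: h2|exact/esym/h0|exact/esym/h1|exact/esym/h2].
have P c i j x : uniq [:: i; j; c] -> x \in pair_sync c <-> x i 0 = x j 0.
  move=> u; rewrite mem_pair_sync; move: (u); rewrite uniq3E => /and3P[ij ic jc].
  split=> [h|h y z yc zc]; first exact: h.
  have [->|->] := uniq3_other u yc; have [->|->] := uniq3_other u zc; rewrite ?h //.
have F x : x \in full_synchrony R 3 <-> x 0 0 = x 1 0 /\ x 0 0 = x 2 0.
  rewrite mem_full_synchrony; split=> [h //|[h1 h2] i j].
  by case: (ord3P i) (ord3P j) => -> [] ->; rewrite -?h1 -?h2.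
have eqD (U : {vspace 'cV[R]_3}) : (forall x, x \in D <-> x \in U) -> D = U.
  by move=> h; apply/vspaceP => x; apply/idP/idP => /h.
case: (e 1 2) (e 0 2) (e 0 1) De => [] [] [] De.
- constructor 1; apply: eqD => x; rewrite De F; split.
    by move=> [_ h1 h2]; split; [exact: h2|exact: h1].
  by move=> [h1 h2]; split=> // _; rewrite -h1.
- constructor 1; apply: eqD => x; rewrite De F; split.
    by move=> [h0 h1 _]; rewrite h0 // h1.
  by move=> [h1 h2]; split=> // _; rewrite -h1.
- constructor 1; apply: eqD => x; rewrite De F; split.
    by move=> [h0 _ h2]; rewrite -h0 // h2.
  by move=> [h1 h2]; split=> // _; rewrite -h1.
- constructor 3; exists 0; apply: eqD => x; rewrite De (P 0 1 2) //.
  by split=> [[h _ _]|h]; [exact: h|split].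
- constructor 1; apply: eqD => x; rewrite De F.
  by split=> [[_ h1 h2]|[h1 h2]]; split=> // *; [exact: h2|exact: h1].
- constructor 3; exists 1; apply: eqD => x; rewrite De (P 1 0 2) //.
  by split=> [[_ h _]|h]; [exact: h|split].
- constructor 3; exists 2; apply: eqD => x; rewrite De (P 2 0 1) //.
  by split=> [[_ _ h]|h]; [exact: h|split].
- by constructor 2; apply: eqD => x; rewrite De memvf; split.
Qed.

End Subspaces.

(** The first directional derivatives are constant functions, and all later ones vanish. *)
Lemma smooth_linear (R : realType) (V W : normedModType R) (f : {linear V -> W}) :
  continuous f -> smooth f.
Proof.
move=> cf [|v vs] x /=; first exact: linear_differentiable.
have [w ->] : exists w, 'D_v (foldr (fun v (g : V -> W) => 'D_v g) f vs) = cst w.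
  elim: vs v => [|v' vs IH] v /=.
    exists (f v); apply/funext => y.
    by rewrite deriveE ?diff_lin //; exact: linear_differentiable.
  have [w ->] := IH v'; exists 0; apply/funext => y; exact: derive_cst.
exact: differentiable_cst.
Qed.

(** The cell function that copies input [l] serves as a test for invariance. *)
Lemma smooth_input (R : realType) k (l : 'I_k) :
  smooth (fun z : R * 'rV[R]_k * R => z.1.2 0 l).
Proof.
pose f (z : R * 'rV[R]_k * R) : R := z.1.2 0 l.
have lf : linear f by move=> r x y; rewrite /f /= !mxE.
pose fM := GRing.isLinear.Build R _ _ _ f lf.
pose fL : {linear (R * 'rV[R]_k * R)%type -> R} := HB.pack f fM.
apply: (@smooth_linear R _ _ fL) => z.
apply: (@continuous_comp _ _ _ (fun z : R * 'rV[R]_k * R => z.1.2) (fun u => u 0 l)).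
  apply: (@continuous_comp _ _ _ fst snd); [exact: cvg_fst|exact: cvg_snd].
exact: coord_continuous.
Qed.

(** * Synchrony subspaces as balanced cells, and their annotations *)

Section Synchrony.
Variables (R : realType) (k : nat) (N : network 3 k).

(** Copying input [l] sends e_c to the indicator of the cells that receive their type [l] edge from
    [c]; invariance makes it constant off [c]. *)
Lemma synchrony_pair_sync c : synchrony N (pair_sync R c) <-> balanced N c.
Proof.
split=> [[_ h]|/balancedP b].
  apply/balancedP => l i j ic jc.
  have /h : smooth (fun z : R * 'rV[R]_k * R => z.1.2 0 l) by exact: smooth_input.
  have dc : delta_mx c 0 \in pair_sync R c.
    by apply/mem_pair_sync => x y xc yc; rewrite !mxE (negPf xc) (negPf yc).
  move=> /(_ 0 _ dc)/mem_pair_sync/(_ i j ic jc)/eqP; rewrite !mxE eqxx !andbT.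
  by case: (N l i == c); case: (N l j == c); rewrite //= ?oner_eq0 // eq_sym oner_eq0.
split; first exact: polydiagonal_pair_sync.
move=> f _ lam x /mem_pair_sync hx; apply/mem_pair_sync => i j ic jc.
rewrite !mxE (hx i j) //; congr (f (_, _, _)).
apply/rowP => l; rewrite !mxE; have := b l i j ic jc.
(* Either both inputs come from [c], or both come from the two cells where [x] agrees. *)
by case: eqVneq => [->|ci] /esym; [move/eqP ->|move/negbT; exact: hx].
Qed.

Lemma synchrony_full_synchrony : synchrony N (full_synchrony R 3).
Proof.
split; first exact: polydiagonal_full_synchrony.
move=> f _ lam x /mem_full_synchrony hx; apply/mem_full_synchrony => i j.
by rewrite !mxE (hx i j); congr (f (_, _, _)); apply/rowP => l; rewrite !mxE.
Qed.

Lemma synchrony_fullv : synchrony N (fullv : {vspace 'cV[R]_3}).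
Proof. by split; [exact: polydiagonal_fullv|move=> *; rewrite memvf]. Qed.

Lemma annotated_bottom :
  annotated_subspace N (full_synchrony R 3) [:: (@valency R k, Repeated 1)].
Proof.
exists 1%N, (fun _ => ord0), (fun _ _ => ord0); split; first split.
- by move=> c; exists 0; apply/val_inj; case: c => [[]].
- move=> x; rewrite mem_full_synchrony; split=> h i j; first by move=> _; apply: h.
  exact: h.
- by [].
apply: (@annotated_simple R 1 k _ [:: @valency R k]).
- by apply: List.Forall_cons; [exact: continuous_valency|exact: List.Forall_nil].
- move=> a; rewrite big_seq1 char_poly1; congr ('X - _%:P).
  rewrite mxE /valency.
  by rewrite -(jacobian_row_sum (fun (l : 'I_k) (i : 'I_1) => ord0 : 'I_1) a 0) big_ord1.
by exists [::].
Qed.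

Lemma annotated_pair_sync c : balanced N c ->
  (exists a : 'rV[R]_k.+1, rvalency a - syn_ev N c a != 0) ->
  annotated_subspace N (pair_sync R c)
    [:: (@valency R k, Repeated 1); (real_complex R \o syn_ev N c, Repeated 1)].
Proof.
move=> b [a0 va0]; pose p (x : 'I_3) : 'I_2 := if x == c then 1 else 0.
have c1 : c + 1 != c by case: (ord3P c) => ->.
exists 2%N, p, (two_cell_quotient N c); split; first split.
- move=> d; have [d1|d1] := eqVneq d 1; first by exists c; rewrite /p eqxx d1.
  exists (c + 1); rewrite /p (negPf c1); apply/val_inj.
  by move: d d1 => [[|[|]]].
- move=> x; rewrite mem_pair_sync; split=> h i j; rewrite /p.
    case: eqVneq => [->|ic]; case: eqVneq => [->|jc] // _; exact: h.
  by move=> ic jc; apply: h; rewrite /p (negPf ic) (negPf jc).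
- move=> l i; rewrite /two_cell_quotient /p.
  have [->|ic] := eqVneq i c; first by rewrite eqxx.
  by move/balancedP: b => /(_ l i (c + 1) ic c1) ->.
set Q := two_cell_quotient N c.
(* With the valency written as the sum of row 0, what remains is the entry (1,1) minus the entry
   (0,1) of the quotient. *)
have E a : \tr (jacobian Q a) - rvalency a = syn_ev N c a.
  rewrite /rvalency -(jacobian_row_sum Q a 0) /mxtrace !big_ord_recl !big_ord0.
  rewrite (_ : lift ord0 ord0 = 1); last exact/val_inj.
  rewrite (_ : ord0 = 0); last exact/val_inj.
  rewrite !addr0 opprD addrACA subrr add0r /syn_ev !jacobianE /Q.
  rewrite /two_cell_quotient !eqxx (negPf c1) /=.
  congr (_ + _ - (_ + _)); apply: eq_bigr => l _; congr (_ * _); by case: (_ == c).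
apply: (@annotated_simple R 2 k Q [:: @valency R k; real_complex R \o syn_ev N c]).
- apply: List.Forall_cons; first exact: continuous_valency.
  apply: List.Forall_cons; last exact: List.Forall_nil.
  exact/continuous_real_complex/polynomial_fun_syn_ev.
- move=> a; rewrite !big_cons big_nil mulr1 /jacobianC -map_char_poly.
  rewrite (char_poly_row_sum2 (jacobian_row_sum Q a)) -/(rvalency a) E.
  by rewrite rmorphM; congr (_ * _); rewrite rmorphB /= map_polyX map_polyC.
have gv := generic_neq0 (polynomial_funB (polynomial_fun_rvalency R k)
  (polynomial_fun_syn_ev R N c)) va0.
apply: generic_imp gv => f fv.
by rewrite /= inE andbT (inj_eq (@complexI R)) -subr_eq0.
Qed.

(** Once the balanced cells are listed, the shape of the lattice and its bottom are known; only the
    planes and the top remain to be annotated. *)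
Lemma annotated_lattice_intro (cs : seq 'I_3)
    (mids : seq ({vspace 'cV[R]_3} * annotation R k)) (top : annotation R k) :
  [seq e.1 | e <- mids] = [seq pair_sync R c | c <- cs] ->
  uniq cs -> (forall c, (c \in cs) = balanced N c) ->
  List.Forall (fun e => annotated_subspace N e.1 e.2) mids ->
  annotated_network N top -> annotated_lattice N mids top.
Proof.
move=> Ds ucs csE am at_; rewrite /annotated_lattice Ds; split.
- move=> D; split=> [sD|].
    have [pD _] := sD; rewrite !inE; have [->|->|[c Dc]] := polydiagonal3P pD.
    + by rewrite eqxx.
    + by rewrite eqxx orbT.
    apply/orP; right; apply/orP; right.
    rewrite Dc; apply: map_f; rewrite csE; apply/synchrony_pair_sync.
    by rewrite -Dc.
  rewrite !inE => /or3P[/eqP->|/eqP->|/mapP[c]].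
  + exact: synchrony_full_synchrony.
  + exact: synchrony_fullv.
  by rewrite csE => b ->; apply/synchrony_pair_sync.
- by apply/allP => D /mapP[c _ ->]; rewrite dim_pair_sync eqxx addvSl subvf.
- rewrite pairwise_map; move: ucs; rewrite uniq_pairwise; apply: sub_pairwise => c c' /= cc'.
  by apply/andP; split; apply: contra cc' => /pair_sync_sub ->.
split; [exact: annotated_bottom|exact: am|].
exists 3, id, N; split=> //; split=> // [c|x]; first by exists c.
by rewrite memvf; split=> // _ i j ->.
Qed.

End Synchrony.

(** * Case distinction *)

Section Cases.
Variables (R : realType) (k : nat) (N : network 3 k).
Implicit Types (a : 'rV[R]_k.+1) (c : 'I_3).

(* The matrix-tree expansion: one term for each spanning tree and each root. *)
Lemma qchar_trees a : let w := jacobian N a in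
  qchar N a = w 1 0 * w 2 0 + w 1 0 * w 2 1 + w 1 2 * w 2 0
    + w 0 1 * w 2 1 + w 0 1 * w 2 0 + w 2 1 * w 0 2
    + w 0 2 * w 1 2 + w 0 2 * w 1 0 + w 1 2 * w 0 1.
Proof.
move=> w; have S x : rvalency a = w x 0 + w x 1 + w x 2.
  by rewrite -(@big_ord3 _ 0 1 2 (w x)) // jacobian_row_sum.
have T : qtrace N a = w 0 0 + w 1 1 + w 2 2 - rvalency a.
  by rewrite /qtrace /mxtrace (@big_ord3 _ 0 1 2).
rewrite /qchar T /qdet /quot_det -/w.
have -> : w 2 2 = rvalency a - w 2 0 - w 2 1 by rewrite (S 2); ring.
have -> : w 1 1 = rvalency a - w 1 0 - w 1 2 by rewrite (S 1); ring.
have -> : w 0 0 = rvalency a - w 0 1 - w 0 2 by rewrite (S 0); ring.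
ring.
Qed.

Let e x y := [exists l, N l x == y].

(** Otherwise [x] would be a connected component by itself. *)
Lemma connected_edge x : net_connected N -> [exists y, (y != x) && (e x y || e y x)].
Proof.
move=> hN; apply: contraT => /existsPn H.
have [i [j u]] := ord3_pair x.
have /and3P[ij ix jx] : [&& i != j, i != x & j != x] by rewrite -uniq3E.
have cl : fingraph.closed (fun y z => [exists l, (N l y == z) || (N l z == y)]) (pred1 x).
  move=> y z /existsP[l hl]; rewrite !inE.
  have := H y; have := H z.
  case: (eqVneq y x) (eqVneq z x) => [ax|ax] [bx|bx] //=; rewrite negb_or.
    case/andP=> /existsPn/(_ l) h1 /existsPn/(_ l) h2; move: hl.
    by rewrite ax (negPf h1) (negPf h2).
  move=> _ /andP[/existsPn/(_ l) h1 /existsPn/(_ l) h2]; move: hl.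
  by rewrite bx (negPf h1) (negPf h2).
by move: (closed_connect cl (hN x i)); rewrite !inE eqxx (negPf ix).
Qed.

Lemma qchar_eq0_two_roots : net_connected N -> (forall a, qchar N a = 0) ->
  exists i j c, [/\ uniq [:: i; j; c], forall l, N l i = i, forall l, N l j = j,
    exists l, N l c = i & exists l, N l c = j].
Proof.
(* At f_0 = 0 and f_1 = ... = f_k = 1, the entries of the Jacobian count edges. *)
move=> hN q0; pose a : 'rV[R]_k.+1 := \row_j (j != ord0)%:R.
have wE x y : jacobian N a x y = \sum_l (N l x == y)%:R.
  rewrite jacobianE mxE eqxx mul0rn add0r; apply: eq_bigr => l _.
  by rewrite mxE eq_sym neq_lift mul1r.
have w0 x y : 0 <= jacobian N a x y by rewrite wE sumr_ge0.
have we x y : e x y -> 0 < jacobian N a x y.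
  case/existsP=> l /eqP lxy; rewrite wE (bigD1 l) //= lxy eqxx.
  by rewrite ltr_wpDr ?sumr_ge0.
have ee x y x' y' : jacobian N a x y * jacobian N a x' y' <= 0 -> ~~ (e x y && e x' y').
  by move=> h; apply/negP => /andP[/we h1 /we h2]; move: (mulr_gt0 h1 h2); rewrite ltNge h.
(* Nine non-negative terms add up to 0, so each vanishes: there is no rooted spanning tree. *)
have := qchar_trees a; rewrite q0 => /= trees.
have p x y x' y' := mulr_ge0 (w0 x y) (w0 x' y').
have p1 := p 1 0 2 0; have p2 := p 1 0 2 1; have p3 := p 1 2 2 0.
have p4 := p 0 1 2 1; have p5 := p 0 1 2 0; have p6 := p 2 1 0 2.
have p7 := p 0 2 1 2; have p8 := p 0 2 1 0; have p9 := p 1 2 0 1.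
have t1 : ~~ (e 1 0 && e 2 0) by apply: ee; lra.
have t2 : ~~ (e 1 0 && e 2 1) by apply: ee; lra.
have t3 : ~~ (e 1 2 && e 2 0) by apply: ee; lra.
have t4 : ~~ (e 0 1 && e 2 1) by apply: ee; lra.
have t5 : ~~ (e 0 1 && e 2 0) by apply: ee; lra.
have t6 : ~~ (e 2 1 && e 0 2) by apply: ee; lra.
have t7 : ~~ (e 0 2 && e 1 2) by apply: ee; lra.
have t8 : ~~ (e 0 2 && e 1 0) by apply: ee; lra.
have t9 : ~~ (e 1 2 && e 0 1) by apply: ee; lra.
have cE x : exists2 y, y != x & e x y || e y x.
  by have /existsP[y /andP[yx h]] := connected_edge x hN; exists y.
(* As every cell is joined to another one, the absence of rooted spanning trees leaves a single
   pattern up to renumbering, found by enumerating the six possible edges. *)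
have [i [j [c [u eci ecj [eij eic eji ejc]]]]] : exists i j c,
    [/\ uniq [:: i; j; c], e c i, e c j &
    [/\ ~~ e i j, ~~ e i c, ~~ e j i & ~~ e j c]].
  clear -t1 t2 t3 t4 t5 t6 t7 t8 t9 cE.
  have c0 : [|| e 0 1, e 1 0, e 0 2 | e 2 0].
    by have [y] := cE 0; case: (ord3P y) => -> // _ /orP[] ->; rewrite ?orbT.
  have c1 : [|| e 0 1, e 1 0, e 1 2 | e 2 1].
    by have [y] := cE 1; case: (ord3P y) => -> // _ /orP[] ->; rewrite ?orbT.
  have c2 : [|| e 0 2, e 2 0, e 1 2 | e 2 1].
    by have [y] := cE 2; case: (ord3P y) => -> // _ /orP[] ->; rewrite ?orbT.
  have : [|| [&& e 0 1, e 0 2, ~~ e 1 0, ~~ e 1 2, ~~ e 2 0 & ~~ e 2 1],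
     [&& e 1 0, e 1 2, ~~ e 0 1, ~~ e 0 2, ~~ e 2 0 & ~~ e 2 1]
   | [&& e 2 0, e 2 1, ~~ e 0 1, ~~ e 0 2, ~~ e 1 0 & ~~ e 1 2]].
    move: c0 c1 c2 t1 t2 t3 t4 t5 t6 t7 t8 t9.
    by case: (e 0 1); case: (e 1 0); case: (e 0 2); case: (e 2 0);
      case: (e 1 2); case: (e 2 1).
  case/or3P => /and5P[h1 h2 h3 h4 /andP[h5 h6]];
    [exists 1, 2, 0|exists 0, 2, 1|exists 0, 1, 2]; by split.
have fixed x y z : uniq [:: y; z; x] -> ~~ e x y -> ~~ e x z -> forall l, N l x = x.
  move=> u' /existsPn h1 /existsPn h2 l; apply/eqP; apply: contraT => h.
  by case: (uniq3_other u' h) => E; [move: (h1 l)|move: (h2 l)]; rewrite E eqxx.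
exists i, j, c; move: (u); rewrite uniq3E => /and3P[ij ic jc]; split=> //.
- by apply: (fixed i j c) => //; rewrite uniq3E jc eq_sym ij eq_sym ic.
- by apply: (fixed j i c) => //; rewrite uniq3E ic ij eq_sym jc.
- by move: eci => /existsP[l /eqP]; exists l.
- by move: ecj => /existsP[l /eqP]; exists l.
Qed.

Lemma balanced_cases :
  [\/ forall c, balanced N c,
      exists i c c', [/\ uniq [:: i; c'; c], balanced N c, balanced N c' & ~~ balanced N i],
      exists i j c, [/\ uniq [:: i; j; c], balanced N c, ~~ balanced N i & ~~ balanced N j]
    | forall c, ~~ balanced N c].
Proof.
case E0: (balanced N 0); case E1: (balanced N 1); case E2: (balanced N 2).
- by constructor 1 => c; case: (ord3P c) => ->.
- by constructor 2; exists 2, 0, 1; rewrite E0 E1 E2.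
- by constructor 2; exists 1, 0, 2; rewrite E0 E1 E2.
- by constructor 3; exists 1, 2, 0; rewrite E0 E1 E2.
- by constructor 2; exists 0, 1, 2; rewrite E0 E1 E2.
- by constructor 3; exists 0, 2, 1; rewrite E0 E1 E2.
- by constructor 3; exists 0, 1, 2; rewrite E0 E1 E2.
by constructor 4 => c; case: (ord3P c) => ->; rewrite (E0, E1, E2).
Qed.

(** [syn_ev N c] is a root of the polynomial whose value at the valency is [qchar]. *)
Lemma qchar_syn_ev a c : balanced N c -> qchar N a != 0 -> rvalency a - syn_ev N c a != 0.
Proof.
move=> b; apply: contra => /eqP h; rewrite /qchar (syn_ev_root a b).
by rewrite (subr0_eq h); apply/eqP; ring.
Qed.

End Cases.

(** * Continuous complex roots of the quadratic factor *)

Section Roots.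
Variables (R : realType) (k : nat) (N : network 3 k).
Implicit Types (a : 'rV[R]_k.+1).
Local Notation rc := (real_complex R).

(* As [Num.sqrt] vanishes on negative numbers, this is (T + s sqrt(T^2 - 4 D)) / 2
   with the complex square root, and it is continuous. *)
Definition qroot (s : R) : eigenfun R k := fun a =>
  Complex ((qtrace N a + s * Num.sqrt (qdisc N a)) / 2) (s * Num.sqrt (- qdisc N a) / 2).

Lemma continuous_qroot s : continuous (qroot s : 'rV[R]_k.+1 -> (R[i])^o).
Proof.
have cdisc := continuous_polynomial_fun (polynomial_fun_qdisc R N).
have csqrt (g : 'rV[R]_k.+1 -> R) : continuous g -> continuous (fun a => s * Num.sqrt (g a)).
  move=> cg a; apply: (@continuousM R _ (fun _ => s) (fun a => Num.sqrt (g a))).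
    exact: cst_continuous.
  exact: (continuous_comp (cg a) (@sqrt_continuous R _)).
have chalf (g : 'rV[R]_k.+1 -> R) : continuous g -> continuous (fun a => g a / 2).
  move=> cg a; apply: (@continuousM R _ g (fun _ => 2^-1)) (cg a) _.
  exact: cst_continuous.
apply: continuous_complex; apply: chalf; last first.
  by apply: csqrt => a; apply: (@continuousN R _ _ (qdisc N)); exact: cdisc.
move=> a; apply: (@continuousD R _ _ (qtrace N) (fun a => s * Num.sqrt (qdisc N a))).
  exact/continuous_polynomial_fun/polynomial_fun_qtrace.
exact: csqrt.
Qed.

Lemma qroot_sum a : qroot 1 a + qroot (- 1) a = rc (qtrace N a).
Proof. by apply/eqP; rewrite eq_complex /=; apply/andP; split; apply/eqP; field. Qed.

Lemma qroot_prod a : qroot 1 a * qroot (- 1) a = rc (qdet N a).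
Proof.
(* One of the two real square roots always vanishes, which kills the imaginary part of the
   product. *)
have [s0 st] : Num.sqrt (qdisc N a) * Num.sqrt (- qdisc N a) = 0 /\
    Num.sqrt (qdisc N a) ^+ 2 - Num.sqrt (- qdisc N a) ^+ 2 = qdisc N a.
  have [d0|d0] := leP 0 (qdisc N a).
    by rewrite [Num.sqrt (- _)]ler0_sqrtr ?oppr_le0 // mulr0 sqr_sqrtr // expr0n subr0.
  by rewrite ler0_sqrtr ?ltW // mul0r sqr_sqrtr ?oppr_ge0 ?ltW // expr0n sub0r opprK.
rewrite /qroot; move: (Num.sqrt (qdisc N a)) (Num.sqrt (- qdisc N a)) s0 st => s t s0 st.
apply/eqP; rewrite eq_complex /=; apply/andP; split; apply/eqP.
  by have -> : qdet N a = (qtrace N a ^+ 2 - qdisc N a) / 4;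
    [rewrite /qdisc; field|rewrite -st; field].
by rewrite -[RHS](mul0r (- 2^-1)) -s0; field.
Qed.

End Roots.

Theorem theorem4p5 (R : realType) (k : nat) (hk : (1 <= k)%N)
    (N : network 3 k) (hN : net_connected N) :
  let v : eigenfun R k := @valency R k in
  (* (a) *)
  (exists (D : {vspace 'cV[R]_3}) (mu : eigenfun R k),
     annotated_lattice N
       [:: (D, [:: (v, Repeated 1); (mu, Repeated 1)])]
       [:: (v, Repeated 2); (mu, Repeated 1)]) \/
  (* (b) *)
  (exists (D1 D2 D3 : {vspace 'cV[R]_3}) (mu : eigenfun R k),
     annotated_lattice N
       [:: (D1, [:: (v, Repeated 1); (mu, Repeated 1)]);
           (D2, [:: (v, Repeated 1); (mu, Repeated 1)]);
           (D3, [:: (v, Repeated 1); (mu, Repeated 1)])]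
       [:: (v, Repeated 1); (mu, Repeated 2)]) \/
  (* (c) *)
  (exists (D : {vspace 'cV[R]_3}) (mu : eigenfun R k),
     annotated_lattice N
       [:: (D, [:: (v, Repeated 1); (mu, Repeated 1)])]
       [:: (v, Repeated 1); (mu, Starred)]) \/
  (* (d) *)
  (exists mu : eigenfun R k,
     annotated_lattice N [::]
       [:: (v, Repeated 1); (mu, Starred)]) \/
  (* (e) *)
  (exists (D1 D2 : {vspace 'cV[R]_3}) (mu1 mu2 : eigenfun R k),
     annotated_lattice N
       [:: (D1, [:: (v, Repeated 1); (mu1, Repeated 1)]);
           (D2, [:: (v, Repeated 1); (mu2, Repeated 1)])]
       [:: (v, Repeated 1); (mu1, Repeated 1); (mu2, Repeated 1)]) \/
  (* (f) *)
  (exists (D : {vspace 'cV[R]_3}) (mu1 mu2 : eigenfun R k),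
     annotated_lattice N
       [:: (D, [:: (v, Repeated 1); (mu1, Repeated 1)])]
       [:: (v, Repeated 1); (mu1, Repeated 1); (mu2, Repeated 1)]) \/
  (* (g) *)
  (exists mu1 mu2 : eigenfun R k,
     annotated_lattice N [::]
       [:: (v, Repeated 1); (mu1, Repeated 1); (mu2, Repeated 1)]).
Proof.
move=> v; pose rc := real_complex R.
have P c c' : balanced N c -> balanced N c' -> c != c' ->
    forall a : 'rV[R]_k.+1, qtrace N a = syn_ev N c a + syn_ev N c' a.
  by move=> b b' cc' a; apply: qtrace_syn_ev.
(* If [qchar] vanishes identically, the valency is always an eigenvalue of the induced map, which is
   case (a). *)
have [Q|Q] := pselect (exists a : 'rV[R]_k.+1, qchar N a != 0); last first.
  have q0 (a : 'rV[R]_k.+1) : qchar N a = 0.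
    by apply: contrapT => /eqP h; apply: Q; exists a.
  have [i [j [c [u Ni Nj [l lci] [l' lcj]]]]] := qchar_eq0_two_roots hN q0.
  have b := two_roots_balanced u Ni Nj.
  have /and3P[ij ic jc] : [&& i != j, i != c & j != c] by rewrite -uniq3E.
  have V : exists a : 'rV[R]_k.+1, rvalency a - syn_ev N c a != 0.
    (* With only the derivative for [l] nonzero, the row of [c] is the unit row at [i], and the
       difference is 1. *)
    exists (delta_mx 0 (lift ord0 l)).
    rewrite (syn_evE _ b ic) (jacobian_root _ _ Ni) (negPf ic) subr0.
    rewrite /rvalency -(jacobian_row_sum N _ c) (big_ord3 _ u) addrK !jacobian_delta.
    by rewrite lci eqxx (negPf ij) addr0 oner_eq0.
  left; exists (pair_sync R c), (rc \o syn_ev N c).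
  apply: (@annotated_lattice_intro R k N [:: c]) => //.
  (* The cells [c] and [y] lie off [x], but only [c] receives from [x] by type [m]. *)
  - have nb x y m : x != c -> y != x -> N m c = x -> (forall l, N l y = y) ->
        balanced N x = false.
      move=> xc yx mc Ny; apply/negP => /balancedP/(_ m c y).
      by rewrite eq_sym xc yx mc Ny eqxx (negPf yx) => /(_ isT isT).
    move=> x; rewrite inE; case: eqVneq => [->|xc]; first by rewrite b.
    case: (uniq3_other u xc) => ->; first by rewrite (nb i j l) // eq_sym.
    by rewrite (nb j i l').
  - apply: List.Forall_cons; last exact: List.Forall_nil.
    exact: annotated_pair_sync.
  exact: (annotated_two_roots u Ni Nj).
have mid c : balanced N c -> annotated_subspace N (pair_sync R c)
    [:: (v, Repeated 1); (rc \o syn_ev N c, Repeated 1)].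
  move=> b; have [a qa] := Q; apply: annotated_pair_sync => //.
  by exists a; apply: qchar_syn_ev.
have csyn c : continuous ((rc \o syn_ev N c) : 'rV[R]_k.+1 -> (R[i])^o).
  exact/continuous_real_complex/polynomial_fun_syn_ev.
right.
(* Three balanced cells give (b), two give (e), one gives (c) or (f), none gives (d) or (g). *)
have [b|[i [c [c' [u b b' nb]]]]|[i [j [c [u b nbi nbj]]]]|nb] := balanced_cases N.
- left.
  (* Any two of the three eigenvalues add up to the trace, so all are equal. *)
  have E c : syn_ev N c = syn_ev N 0 :> ('rV[R]_k.+1 -> R).
    apply/funext => a.
    have h01 := P 0 1 (b _) (b _) isT a; have h02 := P 0 2 (b _) (b _) isT a.
    have h12 := P 1 2 (b _) (b _) isT a.
    by case: (ord3P c) => -> //; lra.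
  exists (pair_sync R 0), (pair_sync R 1), (pair_sync R 2), (rc \o syn_ev N 0).
  apply: (@annotated_lattice_intro R k N [:: 0; 1; 2]) => //.
  + by move=> c; rewrite b; case: (ord3P c) => ->.
  + apply: List.Forall_cons; first exact: mid.
    apply: List.Forall_cons; first by rewrite -(E 1); exact: mid.
    apply: List.Forall_cons; last exact: List.Forall_nil.
    by rewrite -(E 2); exact: mid.
  have T (a : 'rV[R]_k.+1) : qtrace N a = syn_ev N 0 a + syn_ev N 0 a.
    by rewrite (P 0 1 (b _) (b _) isT) (E 1).
  apply: annotated_top_double => //.
  + exact: polynomial_fun_syn_ev.
  + by move=> a; rewrite (syn_ev_root a (b 0)) T addrK.
  + by move=> a x y z xz yz; have /(@balanced_jacobian R) := b z; apply.
  by move=> a c; rewrite E.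
- right; right; right; left.
  have /and3P[ic' ic c'c] : [&& i != c', i != c & c' != c] by rewrite -uniq3E.
  have cc' : c != c' by rewrite eq_sym.
  exists (pair_sync R c), (pair_sync R c'), (rc \o syn_ev N c), (rc \o syn_ev N c').
  apply: (@annotated_lattice_intro R k N [:: c; c']) => //.
  + by rewrite /= inE cc'.
  + move=> x; rewrite !inE; have [->|xc] := eqVneq x c; first by rewrite b.
    by case: (uniq3_other u xc) => ->; [rewrite (negPf ic') (negPf nb)|rewrite eqxx b'].
  + apply: List.Forall_cons; first exact: mid.
    by apply: List.Forall_cons; [exact: mid|exact: List.Forall_nil].
  apply: annotated_top_simple => // [a|a|].
  + by rewrite (P c c') // [RHS]rmorphD.
  + by rewrite (syn_ev_root a b) (P c c') // addrAC subrr add0r [RHS]rmorphM.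
  (* If the discriminant vanished identically, the third cell would be balanced too. *)
  apply: contrapT => D; move/negP: nb; apply; apply: (balanced_third (R := R) u b b') => a.
  by apply: contrapT => /eqP h; apply: D; exists a.
- have cs x : (x \in [:: c]) = balanced N x.
    rewrite inE; have [->|xc] := eqVneq x c; first by rewrite b.
    by case: (uniq3_other u xc) => ->; rewrite (negPf nbi, negPf nbj).
  have am : List.Forall (fun e => annotated_subspace N e.1 e.2)
      [:: (pair_sync R c, [:: (v, Repeated 1); (rc \o syn_ev N c, Repeated 1)])].
    by apply: List.Forall_cons; [exact: mid|exact: List.Forall_nil].
  have [D|D] := pselect (exists a : 'rV[R]_k.+1, qdisc N a != 0).
    (* The second eigenvalue is the trace minus the first. *)
    do 4!right; left; exists (pair_sync R c), (rc \o syn_ev N c),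
      (rc \o (fun a => qtrace N a - syn_ev N c a)).
    apply: (@annotated_lattice_intro R k N [:: c]) => //.
    apply: annotated_top_simple => // [|a|a].
    + apply: continuous_real_complex; apply: polynomial_funB.
        exact: polynomial_fun_qtrace.
      exact: polynomial_fun_syn_ev.
    + by rewrite /= -[LHS]rmorphD subrKC.
    by rewrite /= -[LHS]rmorphM -syn_ev_root.
  right; left; exists (pair_sync R c), (rc \o syn_ev N c).
  apply: (@annotated_lattice_intro R k N [:: c]) => //.
  (* The discriminant equals (T - 2 s)^2 for the known root s. *)
  have T (a : 'rV[R]_k.+1) : qtrace N a = syn_ev N c a + syn_ev N c a.
    have d0 : qdisc N a = 0 by apply: contrapT => /eqP h; apply: D; exists a.
    apply/eqP; rewrite -subr_eq0 -sqrf_eq0; apply/eqP; rewrite -d0 /qdisc.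
    by rewrite (syn_ev_root a b); ring.
  apply: (annotated_top_star Q _ T _ nbi); first exact: polynomial_fun_syn_ev.
  by move=> a; rewrite (syn_ev_root a b) T addrK.
have cs x : (x \in [::]) = balanced N x by rewrite (negPf (nb x)).
have [D|D] := pselect (exists a : 'rV[R]_k.+1, qdisc N a != 0).
  do 5!right; exists (qroot N 1), (qroot N (- 1)).
  apply: (@annotated_lattice_intro R k N [::]) => //.
  apply: annotated_top_simple => //.
  - exact: continuous_qroot.
  - exact: continuous_qroot.
  - exact: qroot_sum.
  exact: qroot_prod.
(* A double root is half of the trace. *)
right; right; left; exists (rc \o (fun a => qtrace N a * 2^-1)).
apply: (@annotated_lattice_intro R k N [::]) => //.
apply: (annotated_top_star Q _ _ _ (nb 0)) => [|a|a].
- apply: polynomial_funM; last exact: polynomial_fun_cst.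
  exact: polynomial_fun_qtrace.
- by field.
have d0 : qdisc N a = 0 by apply: contrapT => /eqP h; apply: D; exists a.
by have -> : qdet N a = (qtrace N a ^+ 2 - qdisc N a) / 4;
  [rewrite /qdisc; field|rewrite d0; field].
Qed.
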